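(* The Hopf monoid $\mathbf{ptt}_{\mathrm{NPtt}}$ is a free monoid (in the category of vector species): as a monoid it is isomorphic to the free monoid $A\mapsto\bigoplus_{(A_1,\ldots,A_\ell)\vDash A}\mathbf{q}[A_1]\otimes\cdots\otimes\mathbf{q}[A_\ell]$ on some vector species $\mathbf{q}$ with $\mathbf{q}[\emptyset]=0$.
   Context: Fix a finite field $\mathbb{F}_q$ with $q$ elements. All sets are finite; $\mathrm{PO}(A)$ is the set of partial orders on $A$. For $\mathcal{R}\in\mathrm{PO}(A)$, the pattern group is $\mathrm{UT}_{\mathcal{R}}=\{u:\{[i,j]\mid i\preceq_{\mathcal{R}}j\}\to\mathbb{F}_q\mid u([i,i])=1\}$ with product $(uv)([i,k])=\sum_{i\preceq_{\mathcal{R}}j\preceq_{\mathcal{R}}k}u([i,j])v([j,k])$. If $\mathcal{Q}$ is a subposet of $\mathcal{R}$ (i.e. $\mathcal{Q}\in\mathrm{PO}(A)$ and $i\preceq_{\mathcal{Q}}j\Rightarrow i\preceq_{\mathcal{R}}j$), $\mathrm{UT}_{\mathcal{Q}}\subseteq\mathrm{UT}_{\mathcal{R}}$ via extension by zero. $\mathrm{NPtt}(\mathcal{R})=\{\mathrm{UT}_{\mathcal{Q}}\triangleleft\mathrm{UT}_{\mathcal{R}}\mid\mathcal{Q}\text{ a subposet of }\mathcal{R}\}$, ordered by inclusion. $\mathrm{Cl}(\mathcal{R})$ is the partition of $\mathrm{UT}_{\mathcal{R}}$ into the sets $N_\circ=\{g\in N\mid g\text{ lies in no element of }\mathrm{NPtt}(\mathcal{R})\text{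 covered by }N\}$, $N\in\mathrm{NPtt}(\mathcal{R})$, and $\mathrm{f}(\mathrm{UT}_{\mathcal{R}};\mathrm{Cl}(\mathcal{R}))$ is the space of functions $\mathrm{UT}_{\mathcal{R}}\to\mathbb{C}$ constant on the blocks of $\mathrm{Cl}(\mathcal{R})$. The species is $\mathbf{ptt}_{\mathrm{NPtt}}[A]=\bigoplus_{\mathcal{R}\in\mathrm{PO}(A)}\mathrm{f}(\mathrm{UT}_{\mathcal{R}};\mathrm{Cl}(\mathcal{R}))$, a complex vector species. For disjoint $A,B$, the product $m_{A,B}:\mathrm{f}(\mathrm{UT}_{\mathcal{P}};\mathrm{Cl}(\mathcal{P}))\otimes\mathrm{f}(\mathrm{UT}_{\mathcal{Q}};\mathrm{Cl}(\mathcal{Q}))\to\mathrm{f}(\mathrm{UT}_{\mathcal{P}.\mathcal{Q}};\mathrm{Cl}(\mathcal{P}.\mathcal{Q}))$, for $\mathcal{P}\in\mathrm{PO}(A)$, $\mathcal{Q}\in\mathrm{PO}(B)$, is inflation $m_{A,B}(\phi\otimes\psi)(u)=\phi(u_A)\psi(u_B)$, where $u_A,u_B$ are the restrictions of $u$ to intervals with both endpoints in $A$, resp. $B$, and $\mathcal{P}.\mathcal{Q}\in\mathrm{PO}(A\cup B)$ has $i\preceq j$ iff $i\preceq_{\mathcal{P}}j$, or $i\preceq_{\mathcal{Q}}j$, or $i\in A$ and $j\in B$. The coproduct $\Delta_{A,B}$ is, for $\mathcal{P}\in\mathrm{PO}(A\cup B)$, restriction of functions from $\mathrm{UT}_{\mathcal{P}}$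 to the subgroup $\mathrm{UT}_{\mathcal{P}|_A}\times\mathrm{UT}_{\mathcal{P}|_B}$ of block elements (entries zero on intervals with one endpoint in $A$ and the other in $B$). A set composition $(A_1,\ldots,A_\ell)\vDash A$ is a sequence of nonempty disjoint sets with union $A$ (for $A=\emptyset$ the only one is the empty sequence, contributing $\mathbb{C}$). The free monoid on $\mathbf{q}$ has concatenation of tensors as product. *)

(* Defs.v *)
From HB Require Import structures.
From mathcomp Require Import all_boot all_order all_algebra all_fingroup.
From mathcomp Require Import generic_quotient boolp reals complex.
From mathcomp.multinomials Require freeg.

Set Implicit Arguments.
Unset Strict Implicit.
Unset Printing Implicit Defensive.

Import GRing.Theory.
Local Open Scope ring_scope.

(* Direct sum of a finite family of vector spaces, as the space of families. *)
Definition dsum (K : fieldType) (I : finType) (V : I -> lmodType K) :=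
  forall i, V i.

Section DirectSum.
Variables (K : fieldType) (I : finType) (V : I -> lmodType K).
Local Notation D := (dsum V).
HB.instance Definition _ := Choice.copy D (forall i, V i).

Let add (x y : D) : D := fun i => x i + y i.
Let opp (x : D) : D := fun i => - x i.
Let zero : D := fun i => 0.
Let scale (a : K) (x : D) : D := fun i => a *: x i.
Fact dsum_addA : associative add.
Proof. by move=> x y z; apply: functional_extensionality_dep => i; exact: addrA. Qed.
Fact dsum_addC : commutative add.
Proof. by move=> x y; apply: functional_extensionality_dep => i; exact: addrC. Qed.
Fact dsum_add0 : left_id zero add.
Proof. by move=> x; apply: functional_extensionality_dep => i; exact: add0r. Qed.
Fact dsum_addN : left_inverse zero opp add.
Proof. by move=> x; apply: functional_extensionality_dep => i; exact: addNr. Qed.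
HB.instance Definition _ :=
  GRing.isZmodule.Build D dsum_addA dsum_addC dsum_add0 dsum_addN.
Fact dsum_scaleA a b x : scale a (scale b x) = scale (a * b) x.
Proof. by apply: functional_extensionality_dep => i; exact: scalerA. Qed.
Fact dsum_scale1 : left_id 1 scale.
Proof. by move=> x; apply: functional_extensionality_dep => i; exact: scale1r. Qed.
Fact dsum_scaleDr : right_distributive scale +%R.
Proof. by move=> a x y; apply: functional_extensionality_dep => i; exact: scalerDr. Qed.
Fact dsum_scaleDl x : {morph scale^~ x : a b / a + b}.
Proof. by move=> a b; apply: functional_extensionality_dep => i; exact: scalerDl. Qed.
HB.instance Definition _ := GRing.Zmodule_isLmodule.Build K D
  dsum_scaleA dsum_scale1 dsum_scaleDr dsum_scaleDl.

Lemma dsumP (x y : D) : (forall i, x i = y i) -> x = y.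
Proof. exact: functional_extensionality_dep. Qed.
Lemma dsum0E i : (0 : D) i = 0. Proof. by []. Qed.
Lemma dsumDE (x y : D) i : (x + y) i = x i + y i. Proof. by []. Qed.
Lemma dsumZE a (x : D) i : (a *: x) i = a *: x i. Proof. by []. Qed.
End DirectSum.

(* The tensor product of two vector spaces: the free vector space on V * W
   modulo the subspace spanned by the bilinearity relations. *)
Module TensorProduct.
Section Tensor.
Import freeg.
Variables (K : fieldType) (V W : lmodType K).

Local Notation free := {freeg (V * W)%type / K}.
Local Notation dl v w := [freeg [:: (1, (v, w))]].

Definition contains_relations (S : {pred free}) :=
  (forall (a : K) v v' w,
      dl (a *: v + v') w - (a *: dl v w + dl v' w) \in S) /\
  (forall (a : K) v w w',
      dl v (a *: w + w') - (a *: dl v w + dl v w') \in S).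

(* The subspace spanned by the relations, as an intersection of subspaces. *)
Definition relations : {pred free} := fun x =>
  `[< forall S : {pred free},
        GRing.submod_closed S -> contains_relations S -> x \in S >].

Fact relations_submod : GRing.submod_closed relations.
Proof.
split=> [|a x y]; first by apply/asboolP => S [].
move=> /asboolP xS /asboolP yS; apply/asboolP => S Ssub Srel.
by apply: Ssub.2; [apply: xS | apply: yS].
Qed.
#[export] HB.instance Definition _ :=
  GRing.isSubmodClosed.Build K free relations relations_submod.
Fact relations_contains : contains_relations relations.
Proof. by split=> *; apply/asboolP => S _ [] ? ?. Qed.

Definition tens : Type := Quotient.quot relations.
#[export] HB.instance Definition _ := GRing.Zmodule.on tens.

Local Notation cls := (\pi_(Quotient.quot relations)%qT : free -> tens).

Lemma cls_eqP x y : reflect (cls x = cls y) (x - y \in relations).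
Proof.
rewrite (Quotient.idealrBE relations).
by apply: (iffP eqP).
Qed.
Lemma cls0 : cls 0 = 0.
Proof. exact: (@raddf0 _ _ \pi_(Quotient.quot relations)%qT). Qed.
Lemma clsD x y : cls (x + y) = cls x + cls y.
Proof. exact: (@raddfD _ _ \pi_(Quotient.quot relations)%qT). Qed.
Lemma cls_repr (x : tens) : cls (repr x) = x. Proof. exact: reprK. Qed.

Definition tens_scale (a : K) (x : tens) : tens := cls (a *: (repr x : free)).
Lemma clsZ a x : cls (a *: x) = tens_scale a (cls x).
Proof.
apply/cls_eqP; rewrite -scalerBr; apply: rpredZ.
by apply/cls_eqP; rewrite cls_repr.
Qed.
Fact tens_scaleA a b x : tens_scale a (tens_scale b x) = tens_scale (a * b) x.
Proof. by rewrite -[x]cls_repr -!clsZ scalerA. Qed.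
Fact tens_scale1 : left_id 1 tens_scale.
Proof. by move=> x; rewrite -[x]cls_repr -clsZ scale1r. Qed.
Fact tens_scaleDr : right_distributive tens_scale +%R.
Proof.
by move=> a x y; rewrite -[x]cls_repr -[y]cls_repr -clsD -!clsZ -clsD scalerDr.
Qed.
Fact tens_scaleDl x : {morph tens_scale^~ x : a b / a + b}.
Proof. by move=> a b; rewrite -[x]cls_repr -!clsZ -clsD scalerDl. Qed.
#[export] HB.instance Definition _ := GRing.Zmodule_isLmodule.Build K tens
  tens_scaleA tens_scale1 tens_scaleDr tens_scaleDl.

Lemma cls_linear a x y : cls (a *: x + y) = a *: cls x + cls y.
Proof. by rewrite clsD clsZ. Qed.

Definition pure (v : V) (w : W) : tens := cls (dl v w).
Lemma pure_linl w : linear (pure^~ w).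
Proof.
move=> a v v'; rewrite /pure -cls_linear; apply/cls_eqP.
exact: relations_contains.1.
Qed.
Lemma pure_linr v : linear (pure v).
Proof.
move=> a w w'; rewrite /pure -cls_linear; apply/cls_eqP.
exact: relations_contains.2.
Qed.

Lemma tens_ind (P : tens -> Prop) :
  P 0 -> (forall a v w x, P x -> P (a *: pure v w + x)) -> forall x, P x.
Proof.
move=> P0 PD x; rewrite -[x]cls_repr -[repr x]freeg_sumE.
elim: (dom _) => [|[v w] s IHs]; first by rewrite big_nil cls0.
rewrite big_cons; set a := coeff _ _.
have ->: << a *g (v, w) >> = a *: dl v w.
  by apply/eqP/freeg_eqP => z; rewrite coeffZ !coeffU mul1r.
by rewrite cls_linear; exact: PD.
Qed.

Section Lift.
Variables (U : lmodType K) (b : V -> W -> U).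
Hypothesis bl : forall w, linear (b^~ w).
Hypothesis br : forall v, linear (b v).
Let h (x : free) : U := fglift (fun p : V * W => b p.1 p.2) x.
Let hB x y : h (x - y) = h x - h y.
Proof. exact: (lift_is_additive (fun p : V * W => b p.1 p.2)). Qed.
Let h0 : h 0 = 0. Proof. by rewrite -(subrr 0) hB subrr. Qed.
Let hD x y : h (x + y) = h x + h y.
Proof. by rewrite -{1}[y]opprK hB -[- y]sub0r hB h0 sub0r opprK. Qed.
Let hU a v w : h << a *g (v, w) >> = a *: b v w.
Proof. by rewrite /h liftU. Qed.
Let hZ a x : h (a *: x) = a *: h x.
Proof.
have hsum s (F : V * W -> K) :
    h (\sum_(z <- s) << F z *g z >>) = \sum_(z <- s) F z *: b z.1 z.2.
  elim: s => [|[v w] s IHs]; first by rewrite !big_nil h0.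
  by rewrite !big_cons hD hU IHs.
rewrite -{2}[x]freeg_sumE (hsum _ (fun z => coeff z x)).
rewrite (hsum (dom x) (fun z => a * coeff z x) : h (a *: x) = _).
by rewrite scaler_sumr; apply: eq_bigr => z _; rewrite scalerA.
Qed.
Let hrel x : x \in relations -> h x = 0.
Proof.
move=> /asboolP/(_ [pred y | h y == 0])/= hx; apply/eqP/hx.
  by split=> [|a y z]; rewrite !inE ?h0 ?hD ?hZ // => /eqP-> /eqP->;
    rewrite scaler0 addr0.
by split=> *; rewrite !inE hB hD hZ !hU !scale1r /= ?bl ?br subrr.
Qed.
Definition tens_lift (x : tens) : U := h (repr x).
Let lift_cls x : tens_lift (cls x) = h x.
Proof.
by apply/eqP; rewrite -subr_eq0 -hB; apply/eqP/hrel/cls_eqP; rewrite cls_repr.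
Qed.
Fact tens_lift_linear : linear tens_lift.
Proof.
move=> a x y; rewrite -[x]cls_repr -[y]cls_repr -cls_linear !lift_cls.
by rewrite hD hZ.
Qed.
Lemma tens_liftE v w : tens_lift (pure v w) = b v w.
Proof. by rewrite lift_cls hU scale1r. Qed.
End Lift.
End Tensor.
Module Exports.
HB.reexport.
End Exports.
End TensorProduct.
Export TensorProduct.Exports.
Notation tens := TensorProduct.tens.
Notation pure := TensorProduct.pure.


Section TensorMap.
Import TensorProduct.
Variables (K : fieldType) (V V' W W' : lmodType K).
Variables (f : {linear V -> V'}) (g : {linear W -> W'}).

Definition tens_map : tens V W -> tens V' W' :=
  tens_lift (fun v w => pure (f v) (g w)).
Let linl w : linear (fun v => pure (f v) (g w)).
Proof. by move=> a v v'; rewrite linearP pure_linl. Qed.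
Let linr v : linear (fun w => pure (f v) (g w)).
Proof. by move=> a w w'; rewrite linearP pure_linr. Qed.
Fact tens_map_linear : linear tens_map.
Proof. exact: tens_lift_linear linl linr. Qed.
HB.instance Definition _ :=
  GRing.isLinear.Build K (tens V W) (tens V' W') _ tens_map tens_map_linear.
Lemma tens_mapE v w : tens_map (pure v w) = pure (f v) (g w).
Proof. exact: tens_liftE linl linr v w. Qed.
End TensorMap.


Record bij (A B : finType) := Bij {
  bij_fun :> A -> B;
  bij_bijective : bijective bij_fun
}.

Lemma bij_eq (A B : finType) (f g : bij A B) : f =1 g -> f = g.
Proof.
case: f g => [f fb] [g gb] /= /funext fg; case: _ / fg gb => gb.
by rewrite (Prop_irrelevance fb gb).
Qed.

Section Bijections.
Variables A A' B B' C : finType.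

Definition bij_id : bij A A := @Bij A A id (Bijective (frefl _) (frefl _)).

Definition bij_comp (g : bij B C) (f : bij A B) : bij A C :=
  Bij (bij_comp (bij_bijective g) (bij_bijective f)).

Definition sum_map (f : A -> A') (g : B -> B') (z : A + B) : A' + B' :=
  match z with inl a => inl (f a) | inr b => inr (g b) end.
Fact sum_map_bij (f : bij A A') (g : bij B B') : bijective (sum_map f g).
Proof.
case: f g => [f [f' fK f'K]] [g [g' gK g'K]] /=.
exists (fun z => match z with inl a => inl (f' a) | inr b => inr (g' b) end);
  by case=> a /=; rewrite ?fK ?gK ?f'K ?g'K.
Qed.
Definition bij_sum (f : bij A A') (g : bij B B') :
    bij (A + B)%type (A' + B')%type :=
  Bij (sum_map_bij f g).

Definition sum_assoc (z : A + B + C) : A + (B + C) :=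
  match z with
  | inl (inl a) => inl a | inl (inr b) => inr (inl b) | inr c => inr (inr c)
  end.
Fact sum_assoc_bij : bijective sum_assoc.
Proof.
exists (fun z => match z with
  | inl a => inl (inl a) | inr (inl b) => inl (inr b) | inr (inr c) => inr c
  end); by [case=> [[]|] | case=> [|[]]].
Qed.
Definition bij_assoc : bij (A + B + C)%type (A + (B + C))%type :=
  Bij sum_assoc_bij.

Definition sum_voidl (z : void + A) : A :=
  match z with inl v => match v with end | inr a => a end.
Fact sum_voidl_bij : bijective sum_voidl.
Proof. by exists inr => [[[]|]|]. Qed.
Definition bij_voidl : bij (void + A)%type A := Bij sum_voidl_bij.

Definition sum_voidr (z : A + void) : A :=
  match z with inl a => a | inr v => match v with end end.
Fact sum_voidr_bij : bijective sum_voidr.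
Proof. by exists inl => [[|[]]|]. Qed.
Definition bij_voidr : bij (A + void)%type A := Bij sum_voidr_bij.
End Bijections.

(* Functors from finite sets and bijections to vector spaces *)
Record species (K : fieldType) := Species {
  sp_obj :> finType -> lmodType K;
  sp_map : forall A B : finType, bij A B -> {linear sp_obj A -> sp_obj B};
  sp_id : forall (A : finType) (x : sp_obj A), sp_map (bij_id A) x = x;
  sp_comp : forall (A B C : finType) (g : bij B C) (f : bij A B) (x : sp_obj A),
    sp_map (bij_comp g f) x = sp_map g (sp_map f x)
}.

(* Monoids for the Cauchy product of species. The product, a linear map        *)
(* M[A] (x) M[B] -> M[A + B] for A + B the disjoint union, is given as a       *)
(* bilinear map and the unit as an element of M[0].                            *)
Record monoid (K : fieldType) := Monoid {
  mon_sp :> species K;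
  mon_mul : forall A B : finType,
    mon_sp A -> mon_sp B -> mon_sp (A + B)%type;
  mon_one : mon_sp void;
  mon_linl : forall A B (y : mon_sp B), linear (fun x : mon_sp A => mon_mul x y);
  mon_linr : forall A B (x : mon_sp A), linear (fun y : mon_sp B => mon_mul x y);
  mon_nat : forall (A A' B B' : finType) (f : bij A A') (g : bij B B')
      (x : mon_sp A) (y : mon_sp B),
    sp_map mon_sp (bij_sum f g) (mon_mul x y)
      = mon_mul (sp_map mon_sp f x) (sp_map mon_sp g y);
  mon_assoc : forall (A B C : finType)
      (x : mon_sp A) (y : mon_sp B) (z : mon_sp C),
    sp_map mon_sp (bij_assoc A B C) (mon_mul (mon_mul x y) z)
      = mon_mul x (mon_mul y z);
  mon_1l : forall (A : finType) (x : mon_sp A),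
    sp_map mon_sp (bij_voidl A) (mon_mul mon_one x) = x;
  mon_1r : forall (A : finType) (x : mon_sp A),
    sp_map mon_sp (bij_voidr A) (mon_mul x mon_one) = x
}.

Record monoid_iso (K : fieldType) (M N : monoid K) := MonoidIso {
  iso_map : forall A : finType, {linear M A -> N A};
  iso_bij : forall A : finType, bijective (iso_map A);
  iso_nat : forall (A B : finType) (f : bij A B) (x : M A),
    iso_map B (sp_map M f x) = sp_map N f (iso_map A x);
  iso_mul : forall (A B : finType) (x : M A) (y : M B),
    iso_map (A + B)%type (mon_mul x y) = mon_mul (iso_map A x) (iso_map B y);
  iso_one : iso_map void (mon_one M) = mon_one N
}.


Definition is_order (A : finType) (r : {set A * A}) : bool :=
  [&& [forall i, (i, i) \in r],
      [forall i, forall j, ((i, j) \in r) && ((j, i) \in r) ==> (i == j)]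
    & [forall i, forall j, forall k,
         ((i, j) \in r) && ((j, k) \in r) ==> ((i, k) \in r)]].

(* i is below j in R when (i, j) \in R; Q is a subposet of R when Q \subset R *)
Record PO (A : finType) := MkPO { po_rel :> {set A * A}; po_orderP : is_order po_rel }.
HB.instance Definition _ (A : finType) := [isSub for @po_rel A].
HB.instance Definition _ (A : finType) := [Finite of PO A by <:].

Section Orders.
Variable A : finType.
Implicit Types (R Q : PO A).

Lemma is_orderP (r : {set A * A}) :
  reflect [/\ forall i, (i, i) \in r,
              forall i j, (i, j) \in r -> (j, i) \in r -> i = j
            & forall i j k, (i, j) \in r -> (j, k) \in r -> (i, k) \in r]
          (is_order r).
Proof.
apply: (iffP and3P) => -[h1 h2 h3]; split.
- by move=> i; exact: (forallP h1).
- by move=> i j ij ji; apply/eqP; move: (forallP (forallP h2 i) j); rewrite ij ji.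
- by move=> i j k ij jk; move: (forallP (forallP (forallP h3 i) j) k); rewrite ij jk.
- exact/forallP.
- by apply/forallP=> i; apply/forallP=> j; apply/implyP=> /andP[ij ji];
    rewrite (h2 i j).
- by apply/forallP=> i; apply/forallP=> j; apply/forallP=> k;
    apply/implyP=> /andP[]; exact: h3.
Qed.

Lemma po_refl R i : (i, i) \in R.
Proof. by have /is_orderP[] := po_orderP R. Qed.
Lemma po_anti R i j : (i, j) \in R -> (j, i) \in R -> i = j.
Proof. by have /is_orderP[_ h _] := po_orderP R; exact: h. Qed.
Lemma po_trans R i j k : (i, j) \in R -> (j, k) \in R -> (i, k) \in R.
Proof. by have /is_orderP[_ _ h] := po_orderP R; exact: h. Qed.

Lemma po_eq R Q : (forall i j, ((i, j) \in R) = ((i, j) \in Q)) -> R = Q.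
Proof. by move=> RQ; apply/val_inj/setP => -[i j]; exact: RQ. Qed.
End Orders.

(* The order induced along an injection, e.g. the restriction to a summand *)
Section Pullback.
Variables (A B : finType) (f : A -> B) (f_inj : injective f) (R : PO B).
Fact po_pull_subproof : is_order [set p | (f p.1, f p.2) \in R].
Proof.
apply/is_orderP; split=> [i|i j|i j k]; rewrite !inE /=; first exact: po_refl.
  by move=> ij ji; apply: f_inj; apply: po_anti ij ji.
exact: po_trans.
Qed.
Definition po_pull : PO A := MkPO po_pull_subproof.
Lemma po_pullE i j : ((i, j) \in po_pull) = ((f i, f j) \in R).
Proof. by rewrite inE. Qed.
End Pullback.

(* The ordinal sum P.Q *)
Section Dot.
Variables (A B : finType) (P : PO A) (Q : PO B).
Definition po_dot_le (x y : A + B) : bool :=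
  match x, y with
  | inl i, inl j => (i, j) \in P
  | inr i, inr j => (i, j) \in Q
  | inl _, inr _ => true
  | inr _, inl _ => false
  end.
Fact po_dot_subproof : is_order [set p | po_dot_le p.1 p.2].
Proof.
apply/is_orderP; split=> [[]i|[]i[]j|[]i[]j[]k]; rewrite !inE //=;
  rewrite ?po_refl //; do ?exact: po_trans.
- by move=> ij ji; congr inl; apply: po_anti ij ji.
- by move=> ij ji; congr inr; apply: po_anti ij ji.
Qed.
Definition po_dot : PO (A + B)%type := MkPO po_dot_subproof.
Lemma po_dotE x y : ((x, y) \in po_dot) = po_dot_le x y.
Proof. by rewrite inE. Qed.
End Dot.

(* Pattern groups. A function on the intervals [i, j] of R is represented by   *)
(* its extension by zero to A * A.                                            *)

Definition is_UT (F : finFieldType) (A : finType) (R : PO A)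
    (u : {ffun A * A -> F}) : bool :=
  [forall i, u (i, i) == 1] && [forall p, (p \notin R) ==> (u p == 0)].

Record UT (F : finFieldType) (A : finType) (R : PO A) :=
  MkUT { ut_val :> {ffun A * A -> F}; ut_valP : is_UT R ut_val }.
HB.instance Definition _ (F : finFieldType) (A : finType) (R : PO A) :=
  [isSub for @ut_val F A R].
HB.instance Definition _ (F : finFieldType) (A : finType) (R : PO A) :=
  [Finite of UT F R by <:].

Section PatternGroup.
Variables (F : finFieldType) (A : finType) (R : PO A).
Local Notation UTR := (UT F R).
Implicit Types u v w : UTR.

Lemma is_UTP (u : {ffun A * A -> F}) :
  reflect ((forall i, u (i, i) = 1) /\ forall i j, (i, j) \notin R -> u (i, j) = 0)
          (is_UT R u).
Proof.
apply: (iffP andP) => -[h1 h2]; split.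
- by move=> i; apply/eqP/(forallP h1).
- by move=> i j ij; apply/eqP/(implyP (forallP h2 (i, j))).
- by apply/forallP=> i; rewrite h1.
- by apply/forallP=> -[i j]; apply/implyP=> /h2 ->.
Qed.
Lemma ut1 u i : u (i, i) = 1.
Proof. by have /is_UTP[] := ut_valP u. Qed.
Lemma ut0 u i j : (i, j) \notin R -> u (i, j) = 0.
Proof. by have /is_UTP[_ h] := ut_valP u; exact: h. Qed.
Lemma ut_eq u v : (forall i k, (i, k) \in R -> u (i, k) = v (i, k)) -> u = v.
Proof.
move=> uv; apply/val_inj/ffunP => -[i k] /=.
by case: (boolP ((i, k) \in R)) => ik; [exact: uv | rewrite !ut0].
Qed.

Definition ut_mul_val u v : {ffun A * A -> F} :=
  [ffun p => \sum_(j | ((p.1, j) \in R) && ((j, p.2) \in R))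
               u (p.1, j) * v (j, p.2)].
Fact ut_mul_subproof u v : is_UT R (ut_mul_val u v).
Proof.
apply/is_UTP; split=> [i|i k ik]; rewrite ffunE /=.
  rewrite (big_pred1 i) ?ut1 ?mul1r // => j; apply/andP/eqP => [[ij ji]|->].
    exact: po_anti ji ij.
  by rewrite po_refl.
rewrite big1 // => j /andP[ij jk].
by rewrite (po_trans ij jk) in ik.
Qed.
Definition ut_mul u v : UTR := MkUT (ut_mul_subproof u v).

Definition ut_one_val : {ffun A * A -> F} := [ffun p => (p.1 == p.2)%:R].
Fact ut_one_subproof : is_UT R ut_one_val.
Proof.
apply/is_UTP; split=> [i|i k ik]; rewrite ffunE /= ?eqxx //.
by case: eqP ik => // ->; rewrite po_refl.
Qed.
Definition ut_one : UTR := MkUT ut_one_subproof.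

Lemma ut_mulE u v i k : ut_mul u v (i, k) = \sum_j u (i, j) * v (j, k).
Proof.
rewrite ffunE /= [RHS](bigID (fun j => ((i, j) \in R) && ((j, k) \in R))) /=.
rewrite [X in _ + X]big1 ?addr0 // => j; rewrite negb_and => /orP[] h.
  by rewrite ut0 ?mul0r.
by rewrite [v _]ut0 ?mulr0.
Qed.

Fact ut_mulA : associative ut_mul.
Proof.
move=> u v w; apply: ut_eq => i k _; rewrite !ut_mulE.
under eq_bigr do rewrite ut_mulE mulr_sumr.
rewrite exchange_big; apply: eq_bigr => j _ /=.
by rewrite ut_mulE mulr_suml; apply: eq_bigr => l _; rewrite mulrA.
Qed.
Fact ut_mul1 : left_id ut_one ut_mul.
Proof.
move=> u; apply: ut_eq => i k _; rewrite ut_mulE (bigD1 i) //= ffunE /= eqxx.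
rewrite mul1r big1 ?addr0 // => j ji.
by rewrite ffunE /= eq_sym (negPf ji) mul0r.
Qed.

Lemma ut_mulI u : injective (ut_mul^~ u).
Proof.
move=> v w vw; apply: ut_eq => i k _; have [n] := ubnP #|[set j | (j, k) \in R]|.
elim: n k => // n IHn k kn.
have := congr1 (fun x : UTR => x (i, k)) vw; rewrite /= !ut_mulE.
rewrite (bigD1 k) //= [RHS](bigD1 k) //= !ut1 !mulr1 => e.
apply: (addIr _ (etrans e _)); congr (_ + _); apply: eq_bigr => j jk.
case: (boolP ((j, k) \in R)) => [jRk|/(ut0 u) ->]; last by rewrite !mulr0.
rewrite IHn // (leq_trans _ (_ : #|[set j | (j, k) \in R]| <= n)%N) //.
apply: proper_card; apply/properP; split.
  by apply/subsetP => l; rewrite !inE => lj; exact: po_trans lj jRk.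
exists k; rewrite !inE ?po_refl //; apply/negP => kj.
by rewrite (po_anti jRk kj) eqxx in jk.
Qed.

Definition ut_inv u : UTR := invF (@ut_mulI u) ut_one.
Fact ut_mulV : left_inverse ut_one ut_inv ut_mul.
Proof. by move=> u; exact: (f_invF (@ut_mulI u)). Qed.

HB.instance Definition _ :=
  Finite_isGroup.Build UTR ut_mulA ut_mul1 ut_mulV.
End PatternGroup.

Section NormalPatterns.
Variables (F : finFieldType) (A : finType) (R : PO A).
Local Notation UTR := (UT F R).
Implicit Types (Q : PO A) (M N L : {set UTR}) (u v : UTR).

(* UT_Q inside UT_R, for Q a subposet of R *)
Definition pattern Q : {set UTR} := [set u : UTR | [forall p, (u p != 0) ==> (p \in Q)]].

Definition NPtt : {set {set UTR}} :=
  [set pattern Q | Q : PO A & (Q \subset R) && (pattern Q <| [set: UTR])%g].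

Definition covered M N : bool :=
  [&& M \in NPtt, N \in NPtt, M \proper N
    & [forall L in NPtt, ~~ ((M \proper L) && (L \proper N))]].

(* The set written N with a circle subscript *)
Definition npt_core N : {set UTR} :=
  [set u in N | [forall M, covered M N ==> (u \notin M)]].

Definition Cl : {set {set UTR}} := [set npt_core N | N in NPtt].

Definition constant_on_Cl (K : choiceType) (phi : {ffun UTR -> K}) : bool :=
  [forall b in Cl, forall u in b, forall v in b, phi u == phi v].

Lemma patternP Q u :
  reflect (forall i j, u (i, j) != 0 -> (i, j) \in Q) (u \in pattern Q).
Proof.
rewrite inE; apply: (iffP forallP) => [h i j|h [i j]].
  exact: (implyP (h (i, j))).
by apply/implyP; exact: h.
Qed.

Lemma NPttP N :
  reflect (exists Q, [/\ Q \subset R, (pattern Q <| [set: UTR])%g & N = pattern Q])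
          (N \in NPtt).
Proof.
apply: (iffP imsetP) => [[Q]|[Q [QR Qn ->]]].
  by rewrite inE => /andP[QR Qn] ->; exists Q.
by exists Q => //; rewrite inE QR.
Qed.

Lemma NPttT : [set: UTR] \in NPtt.
Proof.
have RT : pattern R = [set: UTR].
  apply/setP => u; rewrite [RHS]inE; apply/patternP => i j.
  by apply: contraNT => /ut0 ->.
by apply/NPttP; exists R; rewrite RT normal_refl subxx.
Qed.

Definition poI Q Q' : PO A.
Proof.
exists (Q :&: Q'); apply/is_orderP; split=> [i|i j|i j k]; rewrite !inE.
- by rewrite !po_refl.
- by move=> /andP[h _] /andP[h' _]; exact: po_anti h h'.
- by move=> /andP[h g] /andP[h' g']; rewrite (po_trans h h') (po_trans g g').
Defined.

Lemma NPttI M N : M \in NPtt -> N \in NPtt -> M :&: N \in NPtt.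
Proof.
move=> /NPttP[Q [QR Qn ->]] /NPttP[Q' [Q'R Q'n ->]]; apply/NPttP.
exists (poI Q Q').
have -> : pattern (poI Q Q') = pattern Q :&: pattern Q'.
  apply/setP => u; rewrite in_setI; apply/patternP/andP => [h|[/patternP h /patternP g] i j uij].
    by split; apply/patternP => i j /h; rewrite inE => /andP[].
  by rewrite inE h ?g.
split=> //; first exact: subset_trans (subsetIl _ _) QR.
by apply/andP; split; rewrite ?subsetT // normsI ?normal_norm.
Qed.

(* Two elements are in the same block of Cl exactly when they are in the same *)
(* normal pattern subgroups.                                                  *)
Lemma core_sub N M u : u \in npt_core N -> N \in NPtt -> M \in NPtt ->
  u \in M -> N \subset M.
Proof.
rewrite inE => /andP[uN /forallP uc] NN MN uM; apply/contraT => NM.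
pose P L := [&& L \in NPtt, M :&: N \subset L & L \proper N].
have P0 : P (M :&: N).
  rewrite /P NPttI // subxx properEneq subsetIr andbT.
  by apply: contraNneq NM => <-; rewrite subsetIl.
case: (arg_maxnP (fun L : {set UTR} => #|L|) P0) => L /and3P[LN IL LpN] Lmax.
have /implyP/(_ _)/negP[] := uc L; last by apply: (subsetP IL); rewrite inE uM.
rewrite /covered LN NN LpN; apply/forallP => L'; apply/implyP => L'N.
apply/negP => /andP[LL' L'pN].
have := Lmax L'; rewrite /P L'N L'pN (subset_trans IL (proper_sub LL')).
by move=> /(_ isT) /=; rewrite leqNgt (proper_card LL').
Qed.

Lemma core_exists u : exists N, [/\ N \in NPtt, u \in npt_core N &
  forall v, (forall M, M \in NPtt -> (v \in M) = (u \in M)) -> v \in npt_core N].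
Proof.
pose P L := (L \in NPtt) && (u \in L).
have P0 : P [set: UTR] by rewrite /P NPttT inE.
case: (arg_minnP (fun L : {set UTR} => #|L|) P0) => N /andP[NN uN] Nmin.
have cN v : (forall M, M \in NPtt -> (v \in M) = (u \in M)) -> v \in npt_core N.
  move=> vu; rewrite inE vu // uN; apply/forallP => M; apply/implyP.
  move=> /and4P[MN _ MpN _]; rewrite vu //; apply/negP => uM.
  by have := Nmin M; rewrite /P MN uM => /(_ isT) /=; rewrite leqNgt proper_card.
by exists N; split=> //; exact: cN.
Qed.

Lemma constant_on_ClP (K : choiceType) (phi : {ffun UTR -> K}) :
  reflect (forall u v, (forall M, M \in NPtt -> (v \in M) = (u \in M)) ->
             phi u = phi v)
          (constant_on_Cl phi).
Proof.
apply: (iffP idP) => [h u v uv|h].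
  have [N [NN uN cN]] := core_exists u.
  have bN : npt_core N \in Cl by apply/imsetP; exists N.
  apply/eqP; move: h => /forallP/(_ (npt_core N)); rewrite bN.
  by move=> /forallP/(_ u); rewrite uN => /forallP/(_ v); rewrite cN.
apply/forallP => b; apply/implyP => /imsetP[N NN ->].
apply/forallP => u; apply/implyP => uN; apply/forallP => v; apply/implyP => vN.
have inN w : w \in npt_core N -> w \in N by rewrite inE => /andP[].
apply/eqP/h => M MN; apply/idP/idP => wM.
  exact: (subsetP (core_sub vN NN MN wM)) (inN _ uN).
exact: (subsetP (core_sub uN NN MN wM)) (inN _ vN).
Qed.

Lemma Cl_partition : partition Cl [set: UTR].
Proof.
apply/and3P; split.
- apply/eqP/setP => u; rewrite inE; apply/bigcupP.
  have [N [NN uN _]] := core_exists u; exists (npt_core N) => //.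
  by apply/imsetP; exists N.
- apply/trivIsetP => _ _ /imsetP[M MN ->] /imsetP[N NN ->]; apply: contraR.
  move=> /pred0Pn[u /andP[/= uM uN]].
  have inM L : u \in npt_core L -> u \in L by rewrite inE => /andP[].
  apply/eqP; congr npt_core; apply/eqP; rewrite eqEsubset.
  by rewrite (core_sub uM) ?(core_sub uN) // inM.
apply/imsetP => -[N NN] /esym/setP N0.
have [Q [QR _ NQ]] := NPttP _ NN.
have u_sub : is_UT R [ffun p : A * A => (p \in Q)%:R : F].
  apply/is_UTP; split=> [i|i j ij]; rewrite ffunE ?po_refl //.
  by case: (boolP ((i, j) \in Q)) ij => // /(subsetP QR) ->.
pose u : UTR := MkUT u_sub.
suff: u \in npt_core N by rewrite N0 inE.
rewrite inE NQ inE; apply/andP; split.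
  by apply/forallP => p; apply/implyP; rewrite ffunE; case: (p \in Q); rewrite ?eqxx.
apply/forallP => M; apply/implyP => /and4P[/NPttP[Q' [_ _ ->]] _ Mp _].
apply/negP => /patternP uQ'; have /properP[_ [v /patternP vQ /negP[]]] := Mp.
apply/patternP => i j /vQ ij; apply: uQ'.
by rewrite ffunE ij oner_neq0.
Qed.
End NormalPatterns.

(* f(UT_R; Cl(R)). K^o is K as a vector space over itself. *)
Section ClassFunctions.
Variables (F : finFieldType) (K : fieldType) (A : finType) (R : PO A).

Definition Cl_const : {pred {ffun UT F R -> K^o}} := @constant_on_Cl F A R K.
Fact Cl_const_submod : GRing.submod_closed Cl_const.
Proof.
split=> [|a x y /constant_on_ClP hx /constant_on_ClP hy]; apply/constant_on_ClP.
  by move=> u v _; rewrite !ffunE.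
by move=> u v uv; rewrite !ffunE (hx u v uv) (hy u v uv).
Qed.
HB.instance Definition _ :=
  GRing.isSubmodClosed.Build K {ffun UT F R -> K^o} Cl_const Cl_const_submod.

Record clfun := MkClfun { cf_val :> {ffun UT F R -> K^o}; cf_valP : cf_val \in Cl_const }.
HB.instance Definition _ := [isSub for cf_val].
HB.instance Definition _ := [Choice of clfun by <:].
HB.instance Definition _ := [SubChoice_isSubLmodule of clfun by <:].
End ClassFunctions.

Section UTPull.
Variables (F : finFieldType) (A B : finType) (f : A -> B) (f_inj : injective f).
Variable R : PO B.
Local Notation Rf := (po_pull f_inj R).

(* u restricted to the intervals with both endpoints in the image of A *)
Fact ut_pull_subproof (u : UT F R) :
  is_UT Rf [ffun p : A * A => u (f p.1, f p.2)].
Proof.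
apply/is_UTP; split=> [i|i j]; rewrite ffunE /= ?ut1 //.
by rewrite inE => h; exact: ut0 h.
Qed.
Definition ut_pull (u : UT F R) : UT F Rf := MkUT (ut_pull_subproof u).
Lemma ut_pullE u i j : ut_pull u (i, j) = u (f i, f j).
Proof. by rewrite ffunE. Qed.

Hypothesis convex : forall i k b,
  (f i, b) \in R -> (b, f k) \in R -> exists j, b = f j.

Lemma ut_pullM : {morph ut_pull : u v / (u * v)%g}.
Proof.
move=> u v; apply: ut_eq => i k _; rewrite ut_pullE !ut_mulE.
rewrite [LHS](bigID (mem [set f x | x in A])) /= [X in _ + X]big1 ?addr0; last first.
  move=> b fb; case: (boolP ((f i, b) \in R)) => h; last by rewrite ut0 ?mul0r.
  case: (boolP ((b, f k) \in R)) => h'; last by rewrite [v _]ut0 ?mulr0.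
  by have [j bj] := convex h h'; rewrite bj imset_f in fb.
rewrite big_imset /=; last by move=> x y _ _; exact: f_inj.
by apply: eq_bigr => j _; rewrite !ut_pullE.
Qed.
Lemma ut_pull1 : ut_pull 1%g = 1%g.
Proof. by apply: (mulgI (ut_pull 1%g)); rewrite -ut_pullM !mulg1. Qed.
Lemma ut_pullV u : ut_pull u^-1%g = (ut_pull u)^-1%g.
Proof. by apply: (mulgI (ut_pull u)); rewrite -ut_pullM !mulgV ut_pull1. Qed.

Lemma NPtt_pull N : N \in NPtt F Rf -> ut_pull @^-1: N \in NPtt F R.
Proof.
move=> /NPttP[Q [QR Qn NQ]].
pose q := [set p in R | [forall i, forall j, (p == (f i, f j)) ==> ((i, j) \in Q)]].
have qP a b : reflect ((a, b) \in R /\ forall i j, (a, b) = (f i, f j) -> (i, j) \in Q)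
                      ((a, b) \in q).
  rewrite inE; apply: (iffP andP) => -[abR h]; split=> //.
    by move=> i j e; move/forallP/(_ i)/forallP/(_ j)/implyP: h; apply; apply/eqP.
  by apply/forallP=> i; apply/forallP=> j; apply/implyP=> /eqP; exact: h.
have qo : is_order q.
  apply/is_orderP; split=> [b|a b|a b c].
  - apply/qP; split=> [|i j [-> /f_inj->]]; exact: po_refl.
  - by move=> /qP[ab _] /qP[ba _]; exact: po_anti ab ba.
  move=> /qP[ab hab] /qP[bc hbc]; apply/qP; split; first exact: po_trans ab bc.
  move=> i k [ai ck]; rewrite ai in ab hab; rewrite ck in bc hbc.
  have [j bj] := convex ab bc; rewrite bj in hab hbc.
  exact: po_trans (hab _ _ erefl) (hbc _ _ erefl).
pose Q' := MkPO qo.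
have e : pattern F R Q' = ut_pull @^-1: N.
  apply/setP => u; rewrite [RHS]inE NQ; apply/patternP/patternP => h i j.
    by rewrite ut_pullE => /h /qP[_]; exact.
  move=> uij; apply/qP; split; first by apply: contraNT uij => /ut0 ->.
  by move=> i' j' [ei ej]; apply: h; rewrite ut_pullE -ei -ej.
apply/NPttP; exists Q'; split=> //.
  by apply/subsetP => -[a b] /qP[].
rewrite e /normal subsetT; apply/subsetP => g _; rewrite inE.
apply/subsetP => _ /imsetP[x xN ->]; rewrite !inE in xN *.
rewrite conjgE !ut_pullM ut_pullV -conjgE memJ_norm //.
by rewrite NQ (subsetP (normal_norm Qn)) ?inE.
Qed.

Lemma Cl_const_pull (K : choiceType) (phi : {ffun UT F Rf -> K}) u v :
  constant_on_Cl phi -> (forall M, M \in NPtt F R -> (v \in M) = (u \in M)) ->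
  phi (ut_pull u) = phi (ut_pull v).
Proof.
move=> /constant_on_ClP h uv; apply: h => M /NPtt_pull /uv; by rewrite !inE.
Qed.
End UTPull.

Section PttSpecies.
Variables (F : finFieldType) (K : fieldType).

(* The component at R of an element is its summand in f(UT_R; Cl(R)) *)
Definition ptt_obj (A : finType) : lmodType K :=
  dsum (fun R : PO A => clfun F K R).

Lemma ptt_congr (A : finType) (x : ptt_obj A) (R R' : PO A)
    (u : UT F R) (u' : UT F R') :
  (forall i j, ((i, j) \in R) = ((i, j) \in R')) ->
  (forall i j, u (i, j) = u' (i, j)) -> x R u = x R' u'.
Proof.
move=> /po_eq RR'; move: u'; rewrite -RR' => u' uu'.
by congr (cf_val _ _); apply: ut_eq => i j _; exact: uu'.
Qed.

Lemma ptt_eq (A : finType) (x y : ptt_obj A) :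
  (forall (R : PO A) (u : UT F R), x R u = y R u) -> x = y.
Proof. by move=> xy; apply: dsumP => R; apply/val_inj/ffunP; exact: xy. Qed.

Section Map.
Variables (A B : finType) (f : bij A B).
Let fK := bij_inj (bij_bijective f).

Lemma bij_convex (R : PO B) i k b :
  (f i, b) \in R -> (b, f k) \in R -> exists j, b = f j.
Proof. by move=> _ _; have [g _ gK] := bij_bijective f; exists (g b). Qed.

(* Transport of structure along f *)
Fact ptt_map_subproof (x : ptt_obj A) (R : PO B) :
  [ffun u : UT F R => x (po_pull fK R) (ut_pull fK u)] \in @Cl_const F K B R.
Proof.
apply/constant_on_ClP => u v uv; rewrite !ffunE.
by apply: Cl_const_pull uv; [exact: bij_convex | exact: cf_valP].
Qed.
Definition ptt_map_fun (x : ptt_obj A) : ptt_obj B :=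
  fun R => MkClfun (ptt_map_subproof x R).
Fact ptt_map_linear : linear ptt_map_fun.
Proof. by move=> a x y; apply: ptt_eq => R u; rewrite !ffunE. Qed.
HB.instance Definition _ := GRing.isLinear.Build K (ptt_obj A) (ptt_obj B) _
  ptt_map_fun ptt_map_linear.
Definition ptt_map : {linear ptt_obj A -> ptt_obj B} := ptt_map_fun.
Lemma ptt_mapE x (R : PO B) (u : UT F R) :
  ptt_map x R u = x (po_pull fK R) (ut_pull fK u).
Proof. by rewrite ffunE. Qed.
End Map.

Fact ptt_id (A : finType) (x : ptt_obj A) : ptt_map (bij_id A) x = x.
Proof.
apply: ptt_eq => R u; rewrite ptt_mapE; apply: ptt_congr => i j.
  by rewrite po_pullE.
by rewrite ut_pullE.
Qed.
Fact ptt_comp (A B C : finType) (g : bij B C) (f : bij A B) (x : ptt_obj A) :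
  ptt_map (bij_comp g f) x = ptt_map g (ptt_map f x).
Proof.
apply: ptt_eq => R u; rewrite !ptt_mapE; apply: ptt_congr => i j.
  by rewrite !po_pullE.
by rewrite !ut_pullE.
Qed.

Definition ptt_species : species K := Species ptt_id ptt_comp.

Section Mul.
Variables A B : finType.
Let inlK := @inl_inj A B.
Let inrK := @inr_inj A B.
Local Notation left R := (po_pull inlK R).
Local Notation right R := (po_pull inrK R).

(* Inflation. The component of a product at R involves only the components of   *)
(* the factors at the orders P and Q with R = P.Q, which are the restrictions of  *)
(* R to A and B when they exist; there it is u |-> phi(u_A) psi(u_B).             *)
Definition ptt_mul_val (x : ptt_obj A) (y : ptt_obj B) (R : PO (A + B)%type) :
    {ffun UT F R -> K^o} :=
  [ffun u => if R == po_dot (left R) (right R)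
             then x (left R) (ut_pull inlK u) * y (right R) (ut_pull inrK u)
             else 0].

Fact ptt_mul_subproof x y R : ptt_mul_val x y R \in @Cl_const F K _ R.
Proof.
apply/constant_on_ClP => u v uv; rewrite !ffunE; case: eqP => // RE.
congr (_ * _); (apply: Cl_const_pull uv; last exact: cf_valP).
  by move=> i k [b|b]; [exists b | rewrite RE !po_dotE].
by move=> i k [b|b]; [rewrite RE !po_dotE | exists b].
Qed.
Definition ptt_mul x y : ptt_obj (A + B)%type :=
  fun R => MkClfun (ptt_mul_subproof x y R).
End Mul.

Lemma ptt_mulE A B (x : ptt_obj A) (y : ptt_obj B) R u :
  ptt_mul x y R u =
    if R == po_dot (po_pull (@inl_inj A B) R) (po_pull (@inr_inj A B) R)
    then x _ (ut_pull (@inl_inj A B) u) * y _ (ut_pull (@inr_inj A B) u) else 0.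
Proof. by rewrite ffunE. Qed.

Lemma po_dotP (A B : finType) (R : PO (A + B)%type) :
  reflect (forall a b, ((inl a, inr b) \in R) && ((inr b, inl a) \notin R))
    (R == po_dot (po_pull (@inl_inj A B) R) (po_pull (@inr_inj A B) R)).
Proof.
apply: (iffP eqP) => [-> a b|h]; first by rewrite !po_dotE.
apply: po_eq => -[a|b] [a'|b']; rewrite !po_dotE /= ?inE //.
  by have /andP[] := h a b'.
by have /andP[_ /negPf] := h a' b.
Qed.

Definition ptt_one : ptt_obj void.
Proof.
move=> R; exists [ffun => 1]; apply/constant_on_ClP => u v _; by rewrite !ffunE.
Defined.

Fact ptt_linl A B (y : ptt_obj B) : linear (fun x : ptt_obj A => ptt_mul x y).
Proof.
move=> a x x'; apply: ptt_eq => R u; rewrite !ffunE.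
by case: ifP => _; rewrite ?scaler0 ?addr0 // ?ffunE mulrDl scalerAl.
Qed.
Fact ptt_linr A B (x : ptt_obj A) : linear (fun y : ptt_obj B => ptt_mul x y).
Proof.
move=> a y y'; apply: ptt_eq => R u; rewrite !ffunE.
by case: ifP => _; rewrite ?scaler0 ?addr0 // ?ffunE mulrDr scalerAr.
Qed.

Fact ptt_nat (A A' B B' : finType) (f : bij A A') (g : bij B B')
    (x : ptt_obj A) (y : ptt_obj B) :
  ptt_map (bij_sum f g) (ptt_mul x y) = ptt_mul (ptt_map f x) (ptt_map g y).
Proof.
apply: ptt_eq => R u; rewrite ptt_mapE !ptt_mulE.
congr (if (_ : bool) then _ else _).
  apply/po_dotP/po_dotP => h a b; last by have := h (f a) (g b); rewrite !inE.
  have [[f' _ f'K] [g' _ g'K]] := (bij_bijective f, bij_bijective g).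
  by have := h (f' a) (g' b); rewrite !inE /= f'K g'K.
by rewrite !ptt_mapE; congr (_ * _); apply: ptt_congr => i j;
  rewrite ?po_pullE ?ut_pullE.
Qed.

Let mul_ifl (c d : bool) (p q : K) :
  (if c then (if d then p else 0) * q else 0) = if c && d then p * q else 0.
Proof. by case: c d => [] [] //; rewrite mul0r. Qed.
Let mul_ifr (c d : bool) (p q : K) :
  (if c then p * (if d then q else 0) else 0) = if c && d then p * q else 0.
Proof. by case: c d => [] [] //; rewrite mulr0. Qed.
Fact ptt_assoc (A B C : finType)
    (x : ptt_obj A) (y : ptt_obj B) (z : ptt_obj C) :
  ptt_map (bij_assoc A B C) (ptt_mul (ptt_mul x y) z) = ptt_mul x (ptt_mul y z).
Proof.
apply: ptt_eq => R u; rewrite ptt_mapE !ptt_mulE.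
rewrite mul_ifl mul_ifr; congr (if (_ : bool) then _ else _); last first.
  by rewrite mulrA; congr (_ * _ * _); apply: ptt_congr => i j;
    rewrite ?po_pullE ?ut_pullE.
apply/andP/andP => -[/po_dotP h1 /po_dotP h2]; split; apply/po_dotP.
- move=> a [b|c]; last by have := h1 (inl a) c; rewrite !inE.
  by have := h2 a b; rewrite !inE.
- by move=> b c; have := h1 (inr b) c; rewrite !inE.
- move=> [a|b] c; rewrite !inE; first exact: h1.
  by have := h2 b c; rewrite !inE.
- by move=> a b; have := h1 a (inl b); rewrite !inE.
Qed.

Fact ptt_1l (A : finType) (x : ptt_obj A) :
  ptt_map (bij_voidl A) (ptt_mul ptt_one x) = x.
Proof.
apply: ptt_eq => R u; rewrite ptt_mapE ptt_mulE ifT; last by apply/po_dotP => -[].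
rewrite ffunE mul1r; apply: ptt_congr => i j; first by rewrite !po_pullE.
by rewrite !ut_pullE.
Qed.
Fact ptt_1r (A : finType) (x : ptt_obj A) :
  ptt_map (bij_voidr A) (ptt_mul x ptt_one) = x.
Proof.
apply: ptt_eq => R u; rewrite ptt_mapE ptt_mulE ifT; last by apply/po_dotP => a [].
rewrite ffunE mulr1; apply: ptt_congr => i j; first by rewrite !po_pullE.
by rewrite !ut_pullE.
Qed.

Definition ptt : monoid K := @Monoid K ptt_species (@ptt_mul) ptt_one
  ptt_linl ptt_linr ptt_nat ptt_assoc ptt_1l ptt_1r.

End PttSpecies.

Definition is_comp (A : finType) (s : seq {set A}) : bool :=
  [&& all (fun S => S != set0) s, pairwise (fun S T : {set A} => [disjoint S & T]) s
    & \bigcup_(S <- s) S == [set: A]].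

Record comp (A : finType) :=
  MkComp { comp_seq :> seq {set A}; comp_seqP : is_comp comp_seq }.
HB.instance Definition _ (A : finType) := [isSub for @comp_seq A].
HB.instance Definition _ (A : finType) := [Countable of comp A by <:].

Lemma disjointP (A : finType) (S T : {set A}) :
  reflect (forall a, a \in S -> a \in T -> False) [disjoint S & T].
Proof.
apply: (iffP idP) => [/disjointFr d a /d -> //|h].
by apply/pred0P => a /=; apply/negP => /andP[]; exact: h.
Qed.

Section Compositions.
Variable A : finType.

Lemma is_compP (s : seq {set A}) :
  reflect [/\ set0 \notin s, pairwise (fun S T : {set A} => [disjoint S & T]) s &
              forall a, exists2 S, S \in s & a \in S] (is_comp s).
Proof.
have h0 : all (fun S => S != set0) s = (set0 \notin s).
  by rewrite -has_pred1 -all_predC.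
have hU : reflect (forall a, exists2 S, S \in s & a \in S)
                  (\bigcup_(S <- s) S == [set: A]).
  apply: (iffP eqP) => [h a|h].
    have : a \in \bigcup_(S <- s) S by rewrite h inE.
    by rewrite bigcup_seq => /bigcupP[S Ss aS]; exists S.
  apply/setP => a; rewrite inE bigcup_seq; have [S Ss aS] := h a.
  by apply/bigcupP; exists S.
by rewrite /is_comp h0; apply: (iffP and3P) => -[? ? ?]; split=> //; apply/hU.
Qed.

Lemma comp_size (c : comp A) : (size c <= #|A|)%N.
Proof.
have /is_compP[c0 cd _] := comp_seqP c.
have: forall s : seq {set A}, set0 \notin s ->
    pairwise (fun S T : {set A} => [disjoint S & T]) s -> (size s <= #|\bigcup_(S <- s) S|)%N.
  elim=> [|S s IHs] //=; rewrite inE negb_or big_cons => /andP[S0 s0].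
  move=> /andP[/allP Sd sd]; rewrite cardsU.
  have /eqP-> : S :&: \bigcup_(T <- s) T == set0.
    rewrite setI_eq0 bigcup_seq; apply/disjointP => a aS /bigcupP[T Ts aT].
    by have /disjointP := Sd T Ts; apply; [exact: aS | exact: aT].
  rewrite cards0 subn0 -add1n leq_add ?IHs //.
  by rewrite card_gt0 eq_sym.
by move=> /(_ c c0 cd) h; exact: leq_trans h (max_card _).
Qed.

Definition comp_bseq (c : comp A) : {bseq #|A| of {set A}} :=
  Bseq (comp_size c).
Fact comp_bseqK : pcancel comp_bseq (fun s => insub (s : seq {set A})).
Proof. exact: valK. Qed.
HB.instance Definition _ : isFinite (comp A) := PCanIsFinite comp_bseqK.
End Compositions.

Section CompPull.
Variables (A B : finType) (f : A -> B).
Definition comp_pull_seq (s : seq {set B}) : seq {set A} :=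
  [seq X <- [seq f @^-1: (X : {set B}) | X <- s] | X != set0].
Fact comp_pull_subproof (c : comp B) : is_comp (comp_pull_seq c).
Proof.
have /is_compP[c0 cd cU] := comp_seqP c; apply/is_compP; split.
- by rewrite mem_filter eqxx.
- apply: pairwise_filter; rewrite pairwise_map; apply: sub_pairwise cd => S T ST.
  by apply/disjointP => a; rewrite !inE; move/disjointP: ST; apply.
move=> a; have [S Sc faS] := cU (f a); exists (f @^-1: S); last by rewrite inE.
rewrite mem_filter map_f // andbT; apply/set0Pn.
by exists a; rewrite inE.
Qed.
(* The composition of A induced by one of B along f: empty preimages are dropped. *)
Definition comp_pull (c : comp B) : comp A := MkComp (comp_pull_subproof c).
End CompPull.

Section CompDot.
Variables (A B : finType).
Definition dot_seq (s : seq {set A}) (t : seq {set B}) : seq {set A + B} :=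
  [seq @inl A B @: X | X : {set A} <- s] ++ [seq @inr A B @: X | X : {set B} <- t].
Fact comp_dot_subproof (c : comp A) (d : comp B) : is_comp (dot_seq c d).
Proof.
have /is_compP[c0 cd cU] := comp_seqP c; have /is_compP[d0 dd dU] := comp_seqP d.
apply/is_compP; split.
- rewrite mem_cat; apply/orP => -[] /mapP[S Ss /esym/eqP];
    by rewrite imset_eq0 => /eqP S0; rewrite -S0 Ss in c0 d0.
- rewrite pairwise_cat !pairwise_map; apply/and3P; split.
  + apply/allrelP => _ _ /mapP[S _ ->] /mapP[T _ ->].
    by apply/disjointP => _ /imsetP[a _ ->] /imsetP[b _].
  + apply: sub_pairwise cd => S T /disjointP ST.
    apply/disjointP => _ /imsetP[a aS ->] /imsetP[b bT [ab]].
    by rewrite -ab in bT; exact: ST aS bT.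
  + apply: sub_pairwise dd => S T /disjointP ST.
    apply/disjointP => _ /imsetP[a aS ->] /imsetP[b bT [ab]].
    by rewrite -ab in bT; exact: ST aS bT.
case=> x.
  have [S Sc xS] := cU x; exists (inl @: S); last exact: imset_f.
  by rewrite mem_cat map_f.
have [S Sc xS] := dU x; exists (inr @: S); last exact: imset_f.
by rewrite mem_cat map_f ?orbT.
Qed.
Definition comp_dot (c : comp A) (d : comp B) : comp (A + B)%type :=
  MkComp (comp_dot_subproof c d).
End CompDot.

Lemma comp_pull_im (A B : finType) (f : A -> B) (c : comp A) (d : comp B) :
  injective f -> comp_seq d = [seq f @: X | X : {set A} <- c] -> comp_pull f d = c.
Proof.
move=> fI e; apply: val_inj; rewrite /= /comp_pull_seq e -map_comp.
have -> : [seq ((fun X : {set B} => f @^-1: X) \o (fun X : {set A} => f @: X)) X | X <- c] = c.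
  rewrite -[RHS]map_id; apply: eq_map => S /=.
  by apply/setP => a; rewrite inE mem_imset.
by apply/all_filterP; have /and3P[] := comp_seqP c.
Qed.

Section CompPullDot.
Variables (A B : finType) (a : comp A) (b : comp B) (c : comp (A + B)%type).
Hypothesis cE : comp_seq c = dot_seq a b.
Let filter_id (D : finType) (d : comp D) : [seq X <- d | X != set0] = d.
Proof. by apply/all_filterP; have /and3P[] := comp_seqP d. Qed.
Let filter0 (D E : finType) (s : seq {set D}) :
  [seq X <- [seq set0 | _ <- s] | X != set0] = [::] :> seq {set E}.
Proof. by elim: s => //= ? ? ->; rewrite eqxx. Qed.
Lemma comp_pull_dotl : comp_pull inl c = a.
Proof.
apply: val_inj; rewrite /= cE /comp_pull_seq /dot_seq map_cat filter_cat -!map_comp.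
rewrite -[RHS](filter_id a) -[RHS]cats0 -(@filter0 B A b); congr (filter _ _ ++ filter _ _).
  rewrite -[RHS]map_id; apply: eq_map => X /=.
  by apply/setP => z; rewrite inE mem_imset //; exact: inl_inj.
apply: eq_map => X /=; apply/setP => z; rewrite !inE.
by apply/negP => /imsetP[].
Qed.
Lemma comp_pull_dotr : comp_pull inr c = b.
Proof.
apply: val_inj; rewrite /= cE /comp_pull_seq /dot_seq map_cat filter_cat -!map_comp.
rewrite -[RHS](filter_id b) -[RHS]cat0s -(@filter0 A B a); congr (filter _ _ ++ filter _ _).
  apply: eq_map => X /=; apply/setP => z; rewrite !inE.
  by apply/negP => /imsetP[].
rewrite -[RHS]map_id; apply: eq_map => X /=.
by apply/setP => z; rewrite inE mem_imset //; exact: inr_inj.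
Qed.
End CompPullDot.

Lemma im_comp_pull (A B : finType) (f : bij A B) (d : comp B) :
  [seq f @: X | X : {set A} <- comp_pull f d] = d.
Proof.
have [g fK gK] := bij_bijective f.
have imf (X : {set B}) : f @: (f @^-1: X) = X.
  apply/setP => b; apply/imsetP/idP => [[a]|bX]; first by rewrite inE => ? ->.
  by exists (g b); rewrite ?inE ?gK.
rewrite /= /comp_pull_seq (all_filterP _).
  by rewrite -map_comp -[RHS]map_id; apply: eq_map => X /=.
rewrite all_map; have /and3P[/allP d0 _ _] := comp_seqP d.
apply/allP => X /d0 /=; apply: contraNneq => X0.
by rewrite -(imf X) X0 imset0.
Qed.

Lemma comp_eq (A : finType) (c d : comp A) : comp_seq c = comp_seq d -> c = d.
Proof. exact: val_inj. Qed.

Fact comp_nil_subproof : is_comp ([::] : seq {set void}).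
Proof. by apply/is_compP; split=> // -[]. Qed.
Definition comp_nil : comp void := MkComp comp_nil_subproof.

Definition sub (A : finType) (S : {set A}) : finType := {x : A | x \in S}.

Section ImageBij.
Variables (A B : finType) (f : A -> B) (f_inj : injective f) (S : {set A}).
Definition im_fun (x : sub S) : sub (f @: S) :=
  exist _ (f (sval x)) (imset_f f (valP x)).
Fact im_bij_subproof : bijective im_fun.
Proof.
apply: inj_card_bij; last by rewrite !card_sig card_imset.
by move=> x y [] /f_inj /val_inj.
Qed.
Definition im_bij : bij (sub S) (sub (f @: S)) := Bij im_bij_subproof.
End ImageBij.

Section FreeMonoid.
Variables (K : fieldType) (q : species K).

(* q[S_1] (x) ... (x) q[S_l] for a sequence (S_1, ..., S_l) of subsets of A *)
Fixpoint tensor (A : finType) (s : seq {set A}) : lmodType K :=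
  if s is X :: s' then tens (q (sub X)) (tensor s') else K^o.

Section Scale.
Variables (V : lmodType K) (y : V).
Definition scale_by (a : K^o) : V := (a : K) *: y.
Fact scale_by_linear : linear scale_by.
Proof. by move=> a b c; rewrite /scale_by scalerDl scalerA. Qed.
HB.instance Definition _ := GRing.isLinear.Build K K^o V _ scale_by scale_by_linear.
End Scale.

(* Concatenation of tensors, as a linear map in the first factor *)
Fixpoint tcat (A : finType) (s t : seq {set A}) (y : tensor t) :
    {linear tensor s -> tensor (s ++ t)} :=
  match s return {linear tensor s -> tensor (s ++ t)} with
  | [::] => scale_by y
  | X :: s' => tens_map (idfun : {linear q (sub X) -> q (sub X)}) (tcat s' y)
  end.

(* Transport of tensors along an injection *)
Fixpoint tim (A B : finType) (f : A -> B) (f_inj : injective f) (s : seq {set A}) :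
    {linear tensor s -> tensor [seq f @: X | X : {set A} <- s]} :=
  match s return {linear tensor s -> tensor [seq f @: X | X : {set A} <- s]} with
  | [::] => idfun
  | X :: s' => tens_map (sp_map q (im_bij f_inj X)) (tim f_inj s')
  end.

Definition tcast (A : finType) (s t : seq {set A}) (e : s = t) :
    {linear tensor s -> tensor t} :=
  match e in _ = t return {linear tensor s -> tensor t} with erefl => idfun end.

Definition free_obj (A : finType) : lmodType K :=
  dsum (fun c : comp A => tensor c).

Definition free_map_fun (A B : finType) (f : bij A B) (x : free_obj A) :
    free_obj B :=
  fun c => tcast (im_comp_pull f c) (tim (bij_inj (bij_bijective f)) _ (x (comp_pull f c))).
Fact free_map_linear A B (f : bij A B) : linear (free_map_fun f).
Proof. by move=> a x y; apply: dsumP => c; rewrite /free_map_fun dsumDE dsumZE !linearP. Qed.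
HB.instance Definition _ A B (f : bij A B) :=
  GRing.isLinear.Build K (free_obj A) (free_obj B) _ (free_map_fun f)
    (free_map_linear f).
Definition free_map A B (f : bij A B) : {linear free_obj A -> free_obj B} :=
  free_map_fun f.

(* The component of a product at c is the concatenation of the components at the *)
(* restrictions of c to A and to B when c is the concatenation of these, and is *)
(* zero when c is not a concatenation.                                          *)
Definition free_mul (A B : finType) (x : free_obj A) (y : free_obj B) :
    free_obj (A + B)%type :=
  fun c => match comp_dot (comp_pull inl c) (comp_pull inr c) =P c with
  | ReflectT e =>
      tcast (congr1 (@comp_seq _) e)
        (tcat _ (tim (@inr_inj A B) _ (y (comp_pull inr c)))
           (tim (@inl_inj A B) _ (x (comp_pull inl c))))
  | ReflectF _ => 0
  end.

Definition free_one : free_obj void :=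
  fun c => match comp_seq c as s return tensor s with [::] => (1 : K) | _ => 0 end.

(* Equality of tensors up to an equality of the index sequences *)
Definition teq (A : finType) (s t : seq {set A}) (x : tensor s) (y : tensor t) :=
  exists e : s = t, tcast e x = y.

Section Teq.
Variable A : finType.
Implicit Types s t r : seq {set A}.

Lemma tcast_id s (e : s = s) x : tcast e x = x.
Proof. by rewrite (eq_irrelevance e erefl). Qed.
Lemma teq_eq s (x y : tensor s) : teq x y -> x = y.
Proof. by case=> e <-; rewrite tcast_id. Qed.
Lemma teq_refl s (x : tensor s) : teq x x.
Proof. by exists erefl. Qed.
Lemma teq_sym s t (x : tensor s) (y : tensor t) : teq x y -> teq y x.
Proof. by case=> e; case: _ / e y => y <-; exact: teq_refl. Qed.
Lemma teq_trans t s r (y : tensor t) (x : tensor s) (z : tensor r) :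
  teq x y -> teq y z -> teq x z.
Proof. by case=> e; case: _ / e y => y <-. Qed.
Lemma teq_cast s t (e : s = t) (x : tensor s) : teq (tcast e x) x.
Proof. by apply: teq_sym; exists e. Qed.
Lemma tcast_eq s t (e : s = t) (x : tensor s) (y : tensor t) :
  teq x y -> tcast e x = y.
Proof. by move=> xy; apply: teq_eq; apply: teq_trans (teq_cast _ _) _. Qed.
Lemma teq_tcat s s' t t' (x : tensor s) (x' : tensor s') (y : tensor t) (y' : tensor t') :
  teq x x' -> teq y y' -> teq (tcat s y x) (tcat s' y' x').
Proof.
case=> e <- [e' <-]; case: _ / e; case: _ / e'; by exists erefl.
Qed.
Lemma teq_tim (B : finType) (f : A -> B) (fI : injective f) s t
    (x : tensor s) (y : tensor t) :
  teq x y -> teq (tim fI s x) (tim fI t y).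
Proof. by case=> e <-; case: _ / e; by exists erefl. Qed.

Lemma teq_cons (S T : {set A}) s t (v : q (sub S)) (w : q (sub T)) x y :
  (exists b : bij (sub S) (sub T), (forall a, sval (b a) = sval a) /\ sp_map q b v = w) ->
  S = T -> @teq A s t x y -> @teq A (S :: s) (T :: t) (pure v x) (pure w y).
Proof.
case=> b [bE bw] ST [e xy]; case: _ / ST b bE w bw => b bE w <-.
case: _ / e y xy => y <-; exists erefl => /=; congr pure.
rewrite -[LHS]sp_id; congr (sp_map q _ v); by apply: bij_eq => a; apply: val_inj; rewrite /= bE.
Qed.
End Teq.

Lemma tens_ext (V W U : lmodType K) (f g : {linear tens V W -> U}) :
  (forall v w, f (pure v w) = g (pure v w)) -> f =1 g.
Proof.
move=> fg; apply: (TensorProduct.tens_ind (P := fun x => f x = g x)); first by rewrite !linear0.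
by move=> a v w x fgx; rewrite !linearP fg fgx.
Qed.

Lemma teq_ext (A B : finType) (S : {set B}) (r : seq {set B}) (s t : seq {set A})
   (f : {linear tensor (S :: r) -> tensor s}) (g : {linear tensor (S :: r) -> tensor t})
   (e : s = t) :
  (forall v x, teq (f (pure v x)) (g (pure v x))) -> forall x, tcast e (f x) = g x.
Proof.
move=> h; apply: (@tens_ext _ _ _ (tcast e \o f) g) => v x /=.
exact: tcast_eq.
Qed.

Lemma cast_bij (A : finType) (S T : {set A}) (e : S = T) :
  exists b : bij (sub S) (sub T), forall a, sval (b a) = sval a.
Proof. by case: _ / e; exists (bij_id _). Qed.

Lemma tim_tim (A B C : finType) (f : A -> B) (g : B -> C) (h : A -> C)
    (fI : injective f) (gI : injective g) (hI : injective h) :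
  (forall a, g (f a) = h a) -> forall s x, teq (tim gI _ (tim fI s x)) (tim hI s x).
Proof.
move=> gf s x.
have im (X : {set A}) : g @: (f @: X) = h @: X.
  by rewrite -imset_comp; apply: eq_imset => a /=.
have e t : [seq g @: X | X : {set B} <- [seq f @: X | X : {set A} <- t]]
    = [seq h @: X | X : {set A} <- t].
  by rewrite -map_comp; apply: eq_map => X /=.
exists (e s); elim: s x => [|S s IHs] x; first by rewrite tcast_id.
apply: (teq_ext (f := tim gI _ \o tim fI (S :: s))
   (g := tim hI (S :: s))) => v {}x.
rewrite /= !tens_mapE.
apply: teq_cons; last by exists (e s).
  have [b bE] : exists b : bij (sub (g @: (f @: S))) (sub (h @: S)),
      forall a, sval (b a) = sval a.
    exact: cast_bij.
  exists b; split=> //; rewrite -!sp_comp; congr (sp_map q _ v).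
  by apply: bij_eq => a; apply: val_inj; rewrite /= bE /= gf.
exact: im.
Qed.

Lemma tim_id (A : finType) (f : A -> A) (fI : injective f) :
  (forall a, f a = a) -> forall s x, teq (tim fI s x) x.
Proof.
move=> fE s x.
have im (X : {set A}) : f @: X = X.
  by rewrite -[RHS]imset_id; apply: eq_imset.
have e t : [seq f @: X | X : {set A} <- t] = t.
  by rewrite -[RHS]map_id; apply: eq_map => X /=.
exists (e s); elim: s x => [|S s IHs] x; first by rewrite tcast_id.
apply: (teq_ext (f := tim fI (S :: s))
   (g := idfun)) => v {}x.
rewrite /= !tens_mapE.
apply: teq_cons; last by exists (e s).
  have [b bE] : exists b : bij (sub (f @: S)) (sub S), forall a, sval (b a) = sval a.
    exact: cast_bij.
  exists b; split=> //; rewrite -sp_comp -[RHS]sp_id; congr (sp_map q _ v).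
  by apply: bij_eq => a; apply: val_inj; rewrite /= bE /= fE.
exact: im.
Qed.

Lemma tcatDl (A : finType) (s t : seq {set A}) : 
  forall x, linear (fun y : tensor t => tcat s y x).
Proof.
elim: s => [|S s IHs] x a y z /=.
  by rewrite /scale_by scalerDr !scalerA mulrC.
rewrite -!/(tcat (S :: s) _); move: x; apply: (TensorProduct.tens_ind (P := fun x =>
  tcat (S :: s) (a *: y + z) x = a *: tcat (S :: s) y x + tcat (S :: s) z x)).
  by rewrite !linear0 ?scaler0 addr0.
move=> b v w x IHx.
have E Y : tcat (S :: s) Y (b *: pure v w + x)
    = b *: pure v (tcat s Y w) + tcat (S :: s) Y x.
  rewrite (_ : tcat _ _ _ = b *: tcat (S :: s) Y (pure v w) + tcat (S :: s) Y x).
    by rewrite /= tens_mapE.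
  exact: linearP.
rewrite !E IHx IHs TensorProduct.pure_linr !scalerDr !scalerA [b * a]mulrC.
by rewrite -!addrA; congr (_ + _); rewrite addrCA.
Qed.

Lemma tcat0 (A : finType) (s t : seq {set A}) (x : tensor s) :
  tcat s (0 : tensor t) x = 0.
Proof.
by have := @tcatDl _ s t x (-1) 0 0; rewrite /= scaler0 addr0 scaleN1r addNr.
Qed.

Lemma tim_tcat (A B : finType) (f : A -> B) (fI : injective f) s t 
    (x : tensor s) (y : tensor t) :
  teq (tim fI _ (tcat s y x)) (tcat _ (tim fI _ y) (tim fI _ x)).
Proof.
have e r : [seq f @: X | X : {set A} <- r ++ t] =
  [seq f @: X | X : {set A} <- r] ++ [seq f @: X | X : {set A} <- t].
  exact: map_cat.
exists (e s); elim: s x => [|S s IHs] x.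
  by rewrite tcast_id /= /scale_by linearZ.
apply: (teq_ext (f := tim fI _ \o tcat (S :: s) y)
   (g := tcat _ (tim fI _ y) \o tim fI (S :: s))) => v {}x.
rewrite /= !tens_mapE.
apply: teq_cons; [|by []|by exists (e s)].
by exists (bij_id _); split=> //; rewrite sp_id.
Qed.

Lemma tcat_tcat (A : finType) (s t r : seq {set A})
    (x : tensor s) (y : tensor t) (z : tensor r) :
  teq (tcat _ z (tcat s y x)) (tcat s (tcat t z y) x).
Proof.
have e s' : (s' ++ t) ++ r = s' ++ t ++ r by rewrite catA.
exists (e s); elim: s x => [|S s IHs] x.
  by rewrite tcast_id /= /scale_by linearZ.
apply: (teq_ext (f := tcat _ z \o tcat (S :: s) y)
   (g := tcat (S :: s) (tcat t z y))) => v {}x.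
rewrite /= !tens_mapE.
apply: teq_cons; [|by []|by exists (e s)].
by exists (bij_id _); split=> //; rewrite sp_id.
Qed.

Lemma tcat_nil (A : finType) (s : seq {set A}) (x : tensor s) :
  teq (tcat s (1 : tensor [::]) x) x.
Proof.
have e t : t ++ [::] = t :> seq {set A} by rewrite cats0.
exists (e s); elim: s x => [|S s IHs] x.
  by rewrite tcast_id /= /scale_by; exact: mulr1.
apply: (teq_ext (f := tcat (S :: s) (1 : tensor [::]))
   (g := idfun)) => v {}x.
rewrite /= !tens_mapE.
apply: teq_cons; [|by []|by exists (e s)].
by exists (bij_id _); split=> //; rewrite sp_id.
Qed.

Lemma free_mapE (A B : finType) (f : bij A B) (fI : injective f) (x : free_obj A)
    (c : comp A) (d : comp B) :
  comp_seq d = [seq f @: X | X : {set A} <- c] ->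
  teq (free_map f x d) (tim fI _ (x c)).
Proof.
move=> e; apply: teq_trans (teq_cast _ _) _.
rewrite (Prop_irrelevance (bij_inj _) fI).
by rewrite (comp_pull_im fI e); exact: teq_refl.
Qed.

Lemma free_mulE (A B : finType) (x : free_obj A) (y : free_obj B) (a : comp A) (b : comp B) c
    (lI : injective (@inl A B)) (rI : injective (@inr A B)) :
  comp_seq c = dot_seq a b ->
  teq (free_mul x y c) (tcat _ (tim rI _ (y b)) (tim lI _ (x a))).
Proof.
move=> cE; rewrite /free_mul; case: eqP => [e|].
  apply: teq_trans (teq_cast _ _) _.
  rewrite (Prop_irrelevance (@inl_inj _ _) lI) (Prop_irrelevance (@inr_inj _ _) rI).
  by rewrite (comp_pull_dotl cE) (comp_pull_dotr cE); exact: teq_refl.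
by case; apply: comp_eq; rewrite (comp_pull_dotl cE) (comp_pull_dotr cE) cE.
Qed.

Lemma free_mul0 (A B : finType) (x : free_obj A) (y : free_obj B) c :
  (forall (a : comp A) (b : comp B), comp_seq c <> dot_seq a b) -> free_mul x y c = 0.
Proof.
move=> cE; rewrite /free_mul; case: eqP => // e.
by case: (cE (comp_pull inl c) (comp_pull inr c)); rewrite -[in LHS]e.
Qed.

Fact free_id (A : finType) (x : free_obj A) : free_map (bij_id A) x = x.
Proof.
have fI : injective (bij_id A) by [].
apply: dsumP => c; apply: teq_eq; apply: teq_trans (free_mapE fI x (c := c) _) _.
  rewrite -[LHS]map_id; apply: eq_map => X /=.
  by rewrite imset_id.
exact: tim_id.
Qed.

Fact free_comp (A B C : finType) (g : bij B C) (f : bij A B) (x : free_obj A) :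
  free_map (bij_comp g f) x = free_map g (free_map f x).
Proof.
have [fI gI] := (bij_inj (bij_bijective f), bij_inj (bij_bijective g)).
have hI := bij_inj (bij_bijective (bij_comp g f)).
apply: dsumP => c; apply: teq_eq.
have e1 := esym (im_comp_pull g c); have e2 := esym (im_comp_pull f (comp_pull g c)).
apply: teq_trans (free_mapE hI x (c := comp_pull f (comp_pull g c)) _) _.
  rewrite e1 e2 -map_comp; apply: eq_map => X /=.
  by rewrite -imset_comp.
apply: teq_sym; apply: teq_trans (free_mapE gI _ e1) _.
apply: teq_trans (teq_tim gI (free_mapE fI _ e2)) _.
exact: tim_tim.
Qed.

Definition free_species : species K := Species free_id free_comp.

Fact free_linl A B (y : free_obj B) : linear (fun x : free_obj A => free_mul x y).
Proof.
move=> a x x'; apply: dsumP => c; rewrite dsumDE dsumZE /free_mul.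
by case: eqP => [e|_]; [rewrite dsumDE dsumZE !linearP | rewrite scaler0 addr0].
Qed.
Fact free_linr A B (x : free_obj A) : linear (fun y : free_obj B => free_mul x y).
Proof.
move=> a y y'; apply: dsumP => c; rewrite dsumDE dsumZE /free_mul.
case: eqP => [e|_]; last by rewrite scaler0 addr0.
by rewrite dsumDE dsumZE linearP tcatDl linearP.
Qed.

Fact free_nat (A A' B B' : finType) (f : bij A A') (g : bij B B')
    (x : free_obj A) (y : free_obj B) :
  free_map (bij_sum f g) (free_mul x y) = free_mul (free_map f x) (free_map g y).
Proof.
have [fI gI] := (bij_inj (bij_bijective f), bij_inj (bij_bijective g)).
have hI := bij_inj (bij_bijective (bij_sum f g)).
have [lI rI] := (@inl_inj A B, @inr_inj A B).
have [lI' rI'] := (@inl_inj A' B', @inr_inj A' B').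
have dotE (a : seq {set A}) (b : seq {set B}) : dot_seq [seq f @: X | X : {set A} <- a] [seq g @: X | X : {set B} <- b]
    = [seq bij_sum f g @: X | X : {set A + B} <- dot_seq a b].
  rewrite /dot_seq map_cat -!map_comp; congr (_ ++ _); apply: eq_map => X /=;
    by rewrite -!imset_comp.
apply: dsumP => c; apply: teq_eq.
have e1 := esym (im_comp_pull (bij_sum f g) c).
apply: teq_trans (free_mapE hI _ e1) _.
have [[a [b cE]]|cN] := pselect (exists (a : comp A') (b : comp B'), comp_seq c = dot_seq a b).
  have ea := esym (im_comp_pull f a); have eb := esym (im_comp_pull g b).
  have e2 : comp_seq (comp_pull (bij_sum f g) c)
      = dot_seq (comp_pull f a) (comp_pull g b).
    apply: (inj_map (imset_inj hI)); rewrite -e1 -dotE -ea -eb; exact: cE.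
  apply: teq_trans (teq_tim hI (free_mulE x y lI rI e2)) _.
  apply: teq_sym; apply: teq_trans (free_mulE _ _ lI' rI' cE) _.
  apply: teq_trans _ (teq_sym (tim_tcat _ _ _)).
  apply: teq_tcat.
    apply: teq_trans (teq_tim lI' (free_mapE fI _ ea)) _.
    apply: teq_trans (tim_tim _ _ (inj_comp lI' fI) _ _) _ => //.
    by apply: teq_sym; exact: tim_tim.
  apply: teq_trans (teq_tim rI' (free_mapE gI _ eb)) _.
  apply: teq_trans (tim_tim _ _ (inj_comp rI' gI) _ _) _ => //.
  by apply: teq_sym; exact: tim_tim.
rewrite !free_mul0 ?linear0.
- by exists (esym e1); rewrite linear0.
- by move=> a b cE; case: cN; exists a, b.
move=> a b cE; case: cN; rewrite e1 cE -dotE.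
have im_comp (D E : finType) (h : bij D E) (d : comp D) :
    exists d' : comp E, comp_seq d' = [seq h @: X | X : {set D} <- d].
  have [h' hK h'K] := bij_bijective h; pose k : bij E D := Bij (Bijective h'K hK).
  exists (comp_pull k d); rewrite -[in RHS](im_comp_pull k d) -map_comp.
  rewrite -[LHS]map_id; apply: eq_map => X /=.
  by rewrite -imset_comp -[LHS]imset_id; apply: eq_imset => z /=; rewrite h'K.
have [a' a'E] := im_comp _ _ f a; have [b' b'E] := im_comp _ _ g b.
by exists a', b'; rewrite a'E b'E.
Qed.

Fact free_assoc (A B C : finType)
    (x : free_obj A) (y : free_obj B) (z : free_obj C) :
  free_map (bij_assoc A B C) (free_mul (free_mul x y) z)
    = free_mul x (free_mul y z).
Proof.
have hI := bij_inj (bij_bijective (bij_assoc A B C)).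
have [lI rI] := (@inl_inj (A + B)%type C, @inr_inj (A + B)%type C).
have [lI' rI'] := (@inl_inj A (B + C)%type, @inr_inj A (B + C)%type).
have [lAB rAB] := (@inl_inj A B, @inr_inj A B).
have [lBC rBC] := (@inl_inj B C, @inr_inj B C).
have dotE (a : seq {set A}) (b : seq {set B}) (d : seq {set C}) :
    dot_seq a (dot_seq b d)
    = [seq bij_assoc A B C @: X | X : {set A + B + C} <- dot_seq (dot_seq a b) d].
  rewrite /dot_seq !map_cat -catA -!map_comp.
  by congr (_ ++ (_ ++ _)); apply: eq_map => X /=; rewrite -!imset_comp.
apply: dsumP => c; apply: teq_eq; set c' := comp_pull (bij_assoc A B C) c.
have e1 := esym (im_comp_pull (bij_assoc A B C) c).
apply: teq_trans (free_mapE hI _ e1) _; rewrite -/c' in e1 *.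
have [[a [b [d cE]]]|cN] := pselect (exists (a : comp A) (b : comp B) (d : comp C),
    comp_seq c' = dot_seq (comp_dot a b) d).
  apply: teq_trans (teq_tim hI (free_mulE _ _ lI rI cE)) _.
  apply: teq_trans (tim_tcat _ _ _) _.
  apply: teq_trans (teq_tcat (teq_tim hI (teq_tim lI (free_mulE _ _ lAB rAB _)))
    (teq_refl _)) _ => //.
  have cE' : comp_seq c = dot_seq a (comp_dot b d) by rewrite e1 cE dotE.
  apply: teq_sym; apply: teq_trans (free_mulE _ _ lI' rI' cE') _.
  apply: teq_trans (teq_tcat (teq_refl _)
    (teq_tim rI' (free_mulE _ _ lBC rBC _))) _ => //.
  apply: teq_trans (teq_tcat (teq_refl _) (tim_tcat _ _ _)) _.
  apply: teq_trans (teq_sym (tcat_tcat _ _ _)) _.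
  have hlI : injective (bij_assoc A B C \o inl) by exact: inj_comp hI lI.
  apply: teq_tcat; last first.
    apply: teq_trans (tim_tim _ _ (inj_comp rI' rBC) _ _) _ => //.
    by apply: teq_sym; exact: tim_tim.
  apply: teq_sym; apply: teq_trans (tim_tim _ _ hlI _ _) _ => //.
  apply: teq_trans (tim_tcat _ _ _) _; apply: teq_tcat.
    by apply: tim_tim.
  apply: teq_trans (tim_tim _ _ (inj_comp hlI rAB) _ _) _ => //.
  by apply: teq_sym; exact: tim_tim.
have -> : free_mul (free_mul x y) z c' = 0.
  have [[ab [d cE]]|cN'] := pselect (exists (ab : comp (A + B)%type) (d : comp C),
      comp_seq c' = dot_seq ab d); last first.
    by rewrite free_mul0 // => ab d e; case: cN'; exists ab, d.
  apply: teq_eq; apply: teq_trans (free_mulE _ _ lI rI cE) _.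
  rewrite (@free_mul0 A B) => [|a b abE].
    by exists (esym cE); rewrite !linear0.
  case: cN; exists a, b, d; rewrite cE; congr dot_seq; exact: abE.
rewrite linear0; exists (esym e1); rewrite linear0; apply: esym.
have [[a [bd cE]]|cN'] := pselect (exists (a : comp A) (bd : comp (B + C)%type),
    comp_seq c = dot_seq a bd); last first.
  by rewrite free_mul0 // => a bd e; case: cN'; exists a, bd.
apply: teq_eq; apply: teq_trans (free_mulE _ _ lI' rI' cE) _.
rewrite (@free_mul0 B C) => [|b d bdE].
  exists (esym cE); rewrite linear0.
  by rewrite tcat0 linear0.
case: cN; exists a, b, d; apply: (inj_map (imset_inj hI)).
by rewrite -e1 cE bdE -dotE.
Qed.

Fact free_1l (A : finType) (x : free_obj A) :
  free_map (bij_voidl A) (free_mul free_one x) = x.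
Proof.
have hI := bij_inj (bij_bijective (bij_voidl A)).
have [lI rI] := (@inl_inj void A, @inr_inj void A).
have dE (c : comp A) : comp_seq c
    = [seq bij_voidl A @: X | X : {set void + A} <- dot_seq comp_nil c].
  rewrite /dot_seq /= -map_comp -[LHS]map_id; apply: eq_map => X /=.
  by rewrite -imset_comp -[LHS]imset_id; apply: eq_imset.
apply: dsumP => c; apply: teq_eq.
apply: teq_trans (free_mapE hI _ (c := comp_dot comp_nil c) (dE c)) _.
apply: teq_trans (teq_tim hI (free_mulE _ _ lI rI (a := comp_nil) (b := c) _)) _ => //.
rewrite /= /scale_by scale1r.
apply: teq_trans (tim_tim _ _ (inj_comp hI rI) _ _) _ => //.
exact: tim_id.
Qed.

Fact free_1r (A : finType) (x : free_obj A) :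
  free_map (bij_voidr A) (free_mul x free_one) = x.
Proof.
have hI := bij_inj (bij_bijective (bij_voidr A)).
have [lI rI] := (@inl_inj A void, @inr_inj A void).
have dE (c : comp A) : comp_seq c
    = [seq bij_voidr A @: X | X : {set A + void} <- dot_seq c comp_nil].
  rewrite /dot_seq /= cats0 -map_comp -[LHS]map_id; apply: eq_map => X /=.
  by rewrite -imset_comp -[LHS]imset_id; apply: eq_imset.
apply: dsumP => c; apply: teq_eq.
apply: teq_trans (free_mapE hI _ (c := comp_dot c comp_nil) (dE c)) _.
apply: teq_trans (teq_tim hI (free_mulE _ _ lI rI (a := c) (b := comp_nil) _)) _ => //.
apply: teq_trans (teq_tim hI (tcat_nil _)) _.
apply: teq_trans (tim_tim _ _ (inj_comp hI lI) _ _) _ => //.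
exact: tim_id.
Qed.

Definition free_monoid : monoid K := @Monoid K free_species (@free_mul) free_one
  free_linl free_linr free_nat free_assoc free_1l free_1r.
End FreeMonoid.

(* Main.v *)
From HB Require Import structures.
From mathcomp Require Import all_boot all_order all_algebra all_fingroup.
From mathcomp Require Import boolp reals complex.
Require Import Defs.

Set Implicit Arguments.
Unset Strict Implicit.
Unset Printing Implicit Defensive.

Import GRing.Theory.
Local Open Scope ring_scope.

(** The indicator functions of the normal pattern subgroups UT_Q of UT_R form a
    basis of f(UT_R; Cl(R)), by Moebius inversion on the lattice of these
    subgroups.  Inflation sends the indicators of (Q, R) and (Q', R') to the
    indicator of the ordinal sums (Q.Q', R.R'), so ptt is the linearization of a
    monoid of pairs of orders.  A pair splits along a subset S exactly when Q puts
    every element of S below every element of its complement; R, which contains Q,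
    then splits as well.  The sets S along which Q splits form a chain, so each pair
    factors in a unique way into indecomposable pairs, and ptt is free on the
    species spanned by the latter.  Normality of UT_Q in UT_R is the condition that
    i <=_R j <_Q k <=_R l implies i <_Q l; it restricts to subsets and is preserved
    by gluing along a composition. *)

(** * Pairs of orders and their factorizations *)

Definition pair_pull (A B : finType) (f : A -> B) (fI : injective f)
    (p : PO B * PO B) : PO A * PO A :=
  (po_pull fI p.1, po_pull fI p.2).

Lemma pair_eq (A : finType) (p q : PO A * PO A) :
  (forall i j, ((i, j) \in p.1) = ((i, j) \in q.1)) ->
  (forall i j, ((i, j) \in p.2) = ((i, j) \in q.2)) -> p = q.
Proof. by case: p q => p1 p2 [q1 q2] /= /po_eq-> /po_eq->. Qed.

Section NormalPair.
Variable A : finType.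

(** The field-free form of normality of [UT_Q] in [UT_R] for [p = (Q, R)], see [normal_pattern].
    Dropping [j != k] would let reflexive pairs force the two orders to coincide. *)
Definition normal_pair (p : PO A * PO A) : bool :=
  `[< p.1 \subset p.2 /\ forall i j k l, (i, j) \in p.2 -> (j, k) \in p.1 ->
        j != k -> (k, l) \in p.2 -> (i, l) \in p.1 >].

Lemma normal_pairP (p : PO A * PO A) :
  reflect ((forall i j, (i, j) \in p.1 -> (i, j) \in p.2) /\
           forall i j k l, (i, j) \in p.2 -> (j, k) \in p.1 ->
             j != k -> (k, l) \in p.2 -> (i, l) \in p.1)
          (normal_pair p).
Proof.
apply: (iffP (asboolP _)) => -[sub nrm]; split=> //.
  by move=> i j; exact: (subsetP sub).
by apply/subsetP => -[i j]; exact: sub.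
Qed.
End NormalPair.

Lemma normal_pull (A B : finType) (f : A -> B) (fI : injective f) p :
  normal_pair p -> normal_pair (pair_pull fI p).
Proof.
move=> /normal_pairP[sub nrm]; apply/normal_pairP; split=> [i j|i j k l].
  by rewrite !po_pullE; exact: sub.
rewrite !po_pullE -(inj_eq fI) => ij jk njk kl; exact: nrm ij jk njk kl.
Qed.

Lemma normal_pull_bij (A B : finType) (f : A -> B) (fI : injective f) p :
  bijective f -> normal_pair (pair_pull fI p) = normal_pair p.
Proof.
move=> [g fK gK]; apply/idP/idP; last exact: normal_pull.
move=> /(normal_pull (can_inj gK)); congr normal_pair.
by apply: pair_eq => i j; rewrite !po_pullE !gK.
Qed.

(** In an ordinal sum nothing in [B] lies below anything in [A]. Hence a chain i, j, k, l either
    stays on one side or runs from [A] to [B], and then (i, l) is a relation anyway. *)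
Lemma normal_dot (A B : finType) (p : PO (A + B)%type * PO (A + B)%type) :
  p.1 = po_dot (po_pull (@inl_inj A B) p.1) (po_pull (@inr_inj A B) p.1) ->
  p.2 = po_dot (po_pull (@inl_inj A B) p.2) (po_pull (@inr_inj A B) p.2) ->
  normal_pair p =
    normal_pair (pair_pull (@inl_inj A B) p) && normal_pair (pair_pull (@inr_inj A B) p).
Proof.
move=> d1 d2; apply/idP/andP => [h|[/normal_pairP[sA nA] /normal_pairP[sB nB]]].
  by split; exact: normal_pull.
apply/normal_pairP; split=> [i j|i j k l].
  rewrite d1 d2 !po_dotE.
  by case: i j => i [] j //=; [exact: sA | exact: sB].
rewrite d1 d2 !po_dotE.
case: i j k l => i [] j [] k [] l //=; [exact: nA | exact: nB].
Qed.

Section Indecomposable.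
Variable A : finType.
Implicit Types (S T U : {set A}) (Q : PO A) (s : seq {set A}).

(* The restriction of Q to S is nonempty and not an ordinal sum of two nonempty orders. *)
Definition indec_on S Q : bool :=
  `[< S != set0 /\ forall U,
        (forall a b, a \in S -> b \in S -> a \in U -> b \notin U -> (a, b) \in Q) ->
        (forall a, a \in S -> a \notin U) \/ (forall a, a \in S -> a \in U) >].

(** For a composition [s], this says that its blocks are the indecomposable ordinal summands of [Q],
    listed from bottom to top. *)
Definition good s Q : bool :=
  pairwise (fun S T => setX S T \subset Q) s && all (fun S => indec_on S Q) s.
End Indecomposable.

Section IndecomposablePull.
Variables (A B : finType) (f : A -> B) (fI : injective f) (Q : PO B).

Lemma indec_on_pull (S : {set A}) :
  indec_on S (po_pull fI Q) = indec_on (f @: S) Q.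
Proof.
apply/asboolP/asboolP => -[S0 h]; split.
- by rewrite imset_eq0.
- move=> U hU; have [a b aS bS|nU|inU] := h (f @^-1: U).
  + by rewrite !inE /= => aU bU; apply: hU; rewrite ?imset_f.
  + by left=> _ /imsetP[a aS ->]; have := nU a aS; rewrite inE.
  + by right=> _ /imsetP[a aS ->]; have := inU a aS; rewrite inE.
- by rewrite imset_eq0 in S0.
move=> U hU; have [|nU|inU] := h (f @: U).
- move=> _ _ /imsetP[a aS ->] /imsetP[b bS ->]; rewrite !mem_imset // => aU bU.
  by have := hU a b aS bS aU bU; rewrite po_pullE.
- by left=> a aS; have := nU _ (imset_f f aS); rewrite mem_imset.
- by right=> a aS; have := inU _ (imset_f f aS); rewrite mem_imset.
Qed.

Lemma setX_im (S T : {set A}) :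
  (setX (f @: S) (f @: T) \subset Q) = (setX S T \subset po_pull fI Q).
Proof.
apply/subsetP/subsetP => [h [a b]|h [x y]]; rewrite in_setX.
  by case/andP=> aS bT; rewrite po_pullE; apply: h; rewrite in_setX !imset_f.
case/andP=> /imsetP[a aS ->{x}] /imsetP[b bT ->{y}].
by have := h (a, b); rewrite po_pullE in_setX aS bT; exact.
Qed.

Lemma good_im (s : seq {set A}) :
  good [seq f @: X | X : {set A} <- s] Q = good s (po_pull fI Q).
Proof.
rewrite /good pairwise_map all_map; congr (_ && _).
  by apply: eq_pairwise => S T /=; rewrite setX_im.
by apply: eq_all => S /=; rewrite indec_on_pull.
Qed.
End IndecomposablePull.

(** * Unique factorization of an order into indecomposable ordinal summands *)

Section Factorization.
Variables (A : finType) (Q : PO A).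
Implicit Types (S T U : {set A}) (s : seq {set A}).

Definition factorization T s : Prop :=
  [/\ set0 \notin s, pairwise (fun S T : {set A} => [disjoint S & T]) s, good s Q
    & \bigcup_(S <- s) S = T].

(** Splits off the bottom factor, which is the induction step for uniqueness. *)
Lemma factorization_cons T S s : factorization T (S :: s) ->
  [/\ indec_on S Q, S \subset T,
      forall a b, a \in S -> b \in T -> b \notin S -> (a, b) \in Q
    & factorization (T :\: S) s].
Proof.
case=> /=; rewrite inE negb_or /good /= => /andP[S0 s0] /andP[/allP Sd sd].
move=> /andP[/andP[/allP SQ sQ] /andP[Si si]]; rewrite big_cons => sT.
split=> //; first by rewrite -sT subsetUl.
  move=> a b aS; rewrite -sT inE => /orP[->//|]; rewrite bigcup_seq.
  move=> /bigcupP[X Xs bX] _; apply: (subsetP (SQ X Xs)).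
  by rewrite inE /= aS.
split=> //; first by apply/andP.
rewrite -sT setDUl setDv set0U; apply/esym/setDidPl; rewrite disjoint_sym bigcup_seq.
apply/disjointP => a aS /bigcupP[X Xs aX].
by have /disjointP := Sd X Xs; apply; [exact: aS | exact: aX].
Qed.

(** Two candidate bottom factors [S] and [S'] split each other, so by indecomposability [S] is
    disjoint from [S'] or contained in it. Disjointness would put an element of each below an
    element of the other, against antisymmetry; the reverse inclusion is symmetric. *)
Lemma factorization_uniq T s s' : factorization T s -> factorization T s' -> s = s'.
Proof.
elim: s s' T => [|S s IHs] [|S' s'] T //.
- move=> [_ _ _ <-]; rewrite big_nil => /factorization_cons[/asboolP[S0 _]].
  by rewrite subset0 (negPf S0).
- move=> h [_ _ _ T0]; move: h; rewrite -T0 big_nil.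
  by move=> /factorization_cons[/asboolP[S0 _]]; rewrite subset0 (negPf S0).
move=> /factorization_cons[/asboolP[S0 Si] ST SQ fs].
move=> /factorization_cons[/asboolP[S'0 S'i] S'T S'Q fs'].
have SS' : S = S'.
  have [a aS] := set0Pn _ S0; have [a' aS'] := set0Pn _ S'0.
  have [|dis|SsS'] := Si S'.
  - by move=> x y xS yS xS' yS'; apply: S'Q => //; exact: (subsetP ST).
  - have a'S : a' \notin S by apply: contraL aS' => /dis.
    have aQ := SQ a a' aS (subsetP S'T _ aS') a'S.
    have a'Q := S'Q a' a aS' (subsetP ST _ aS) (dis a aS).
    by rewrite (po_anti aQ a'Q) (negPf a'S) in aS.
  have [|dis|S'sS] := S'i S.
  - by move=> x y xS' yS' xS yS; apply: SQ => //; exact: (subsetP S'T).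
  - by have := dis a (SsS' a aS); rewrite aS.
  by apply/setP => x; apply/idP/idP => [/SsS'|/S'sS].
by rewrite -SS' in fs' *; rewrite (IHs _ _ fs fs').
Qed.

(** A nonempty [S] of least size lying below the rest of [T] serves as bottom factor, and induction
    on the size of [T] factors the rest. *)
Lemma factorization_exists T : exists s, factorization T s.
Proof.
have [n] := ubnP #|T|; elim: n T => // n IHn T Tn.
have [->|T0] := eqVneq T set0; first by exists [::]; split; rewrite ?big_nil.
pose P S := [&& S != set0, S \subset T & setX S (T :\: S) \subset Q].
have PT : P T.
  by rewrite /P T0 subxx setDv; apply/subsetP => -[a b]; rewrite !inE andbF.
case: (arg_minnP (fun S : {set A} => #|S|) PT) => S /and3P[S0 ST SQ] Smin.
have [s [s0 sd /andP[sQ si] sT]] : exists s, factorization (T :\: S) s.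
  apply: IHn; rewrite (leq_trans _ (_ : #|T| <= n)%N) //.
  rewrite cardsD (setIidPr ST) ltn_subrL !card_gt0 S0.
  by rewrite T0.
have sub_s X : X \in s -> X \subset T :\: S.
  by move=> Xs; rewrite -sT bigcup_seq; exact: bigcup_sup.
exists (S :: s); split.
- by rewrite inE negb_or eq_sym S0.
- rewrite /= sd andbT; apply/allP => X Xs; apply/disjointP => a aS aX.
  by have := subsetP (sub_s X Xs) a aX; rewrite inE aS.
- rewrite /good /= sQ si !andbT; apply/andP; split.
    apply/allP => X Xs; apply: subset_trans SQ.
    by apply/subsetP => -[a b]; rewrite !in_setX => /andP[-> /(subsetP (sub_s X Xs))].
  apply/asboolP; split=> // U hU.
  have [SU0|SU0] := eqVneq (S :&: U) set0.
    left=> a aS; apply/negP => aU.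
    by have : a \in S :&: U by [rewrite inE aS]; rewrite SU0 inE.
  right=> a aS; apply: contraT => aU.
  (* A set [U] properly splitting [S] would make [S :&: U] a smaller candidate than [S]. *)
  have := Smin (S :&: U); rewrite /P SU0 (subset_trans (subsetIl _ _) ST) /=.
  have -> : setX (S :&: U) (T :\: (S :&: U)) \subset Q.
    apply/subsetP => -[x y]; rewrite !inE /= => /andP[/andP[xS xU] /andP[yn yT]].
    case: (boolP (y \in S)) yn => /= [yS yU|yS _]; first exact: hU.
    by apply: (subsetP SQ); rewrite !inE /= xS yS.
  move=> /(_ isT); rewrite leqNgt => /negP[]; apply: proper_card.
  apply/properP; split; first exact: subsetIl.
  by exists a; rewrite ?inE ?(negPf aU) ?andbF.
by rewrite big_cons sT setDE setUIr setUCr setIT; apply/setUidPr.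
Qed.

Lemma good_uniq (c d : comp A) : good c Q -> good d Q -> c = d.
Proof.
have fc (e : comp A) : good e Q -> factorization [set: A] e.
  by have /and3P[e0 ed /eqP eT] := comp_seqP e => eQ; split=> //; apply/negP => /(allP e0)/eqP.
by move=> /fc hc /fc hd; apply/comp_eq; exact: factorization_uniq hc hd.
Qed.

Lemma good_exists : exists c : comp A, good c Q.
Proof.
have [s [s0 sd sQ sT]] := factorization_exists [set: A].
have sc : is_comp s.
  rewrite /is_comp sd sT eqxx !andbT; apply/allP => S Ss.
  by apply: contraNneq s0 => <-.
by exists (MkComp sc).
Qed.
End Factorization.

(** * Normal pattern subgroups *)

Section NormalPattern.
Variables (F : finFieldType) (A : finType) (Q R : PO A).

Lemma elem_ut_subproof (a b : A) : (a, b) \in R ->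
  is_UT R [ffun p : A * A => ((p.1 == p.2) || (p == (a, b)))%:R : F].
Proof.
move=> ab; apply/is_UTP; split=> [i|i j ij]; rewrite ffunE /= ?eqxx //.
case: eqP ij => [->|_ ij]; first by rewrite po_refl.
by case: eqP ij => // ->; rewrite ab.
Qed.
(** The elementary matrix 1 + e_ab when a and b differ, and the identity when they coincide. *)
Definition elem_ut a b (ab : (a, b) \in R) : UT F R := MkUT (elem_ut_subproof ab).

Lemma elem_utE a b (ab : (a, b) \in R) i j :
  elem_ut ab (i, j) = ((i == j) || ((i == a) && (j == b)))%:R.
Proof. by rewrite ffunE. Qed.

Lemma elem_ut_pattern a b (ab : (a, b) \in R) :
  (a, b) \in Q -> elem_ut ab \in pattern F R Q.
Proof.
move=> abQ; apply/patternP => i j; rewrite elem_utE.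
case: (eqVneq i j) => [->|_]; first by rewrite po_refl.
by case: (eqVneq i a) => [->|_]; case: (eqVneq j b) => [->|_] //=; rewrite eqxx.
Qed.

Lemma sum_elem_utl a b (ab : (a, b) \in R) (v : A -> F) i :
  a != b -> \sum_j elem_ut ab (i, j) * v j = v i + (i == a)%:R * v b.
Proof.
move=> nab; rewrite (bigD1 i) // elem_utE eqxx mul1r; congr (_ + _).
have [->|ia] := eqVneq i a.
  rewrite (bigD1 b) 1?eq_sym // elem_utE !eqxx orbT big1 => [|j /andP[/andP[_ ja] jb]]; first exact: addr0.
  by rewrite elem_utE eq_sym (negPf ja) (negPf jb) andbF mul0r.
rewrite mul0r big1 // => j /andP[_ ji].
by rewrite elem_utE eq_sym (negPf ji) (negPf ia) mul0r.
Qed.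

Lemma sum_elem_utr a b (ab : (a, b) \in R) (v : A -> F) k :
  a != b -> \sum_j v j * elem_ut ab (j, k) = v k + v a * (k == b)%:R.
Proof.
move=> nab; rewrite (bigD1 k) // elem_utE eqxx mulr1; congr (_ + _).
have [->|kb] := eqVneq k b.
  rewrite (bigD1 a) // elem_utE !eqxx orbT big1 => [|j /andP[/andP[_ jb] ja]]; first exact: addr0.
  by rewrite elem_utE (negPf ja) (negPf jb) mulr0.
rewrite mulr0 big1 // => j /andP[_ jk].
by rewrite elem_utE (negPf jk) (negPf kb) andbF mulr0.
Qed.

Lemma pattern_conj (u g : UT F R) :
  (pattern F R Q <| [set: UT F R])%g -> u \in pattern F R Q ->
  (u ^ g)%g \in pattern F R Q.
Proof. by move=> /normal_norm/subsetP n uQ; rewrite memJ_norm // n ?inE. Qed.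

Lemma ut_mulgE (u v : UT F R) i k : (u * v)%g (i, k) = \sum_j u (i, j) * v (j, k).
Proof. exact: ut_mulE. Qed.

(** For necessity, conjugating an elementary matrix by another one produces a nonzero entry at the
    composite interval. For sufficiency, the condition makes every off-diagonal contribution to an
    entry outside [Q] of a conjugate vanish. *)
Lemma normal_pattern :
  (Q \subset R) && (pattern F R Q <| [set: UT F R])%g = normal_pair (Q, R).
Proof.
apply/andP/normal_pairP => /= -[].
  (* The interval is first extended on the right only; the extension on the left then starts from
     (j, l). *)
  move=> /subsetP sub nQ; have trr j k l : (j, k) \in Q -> j != k -> (k, l) \in R ->
      (j, l) \in Q.
    move=> jk njk kl; have [<- //|nkl] := eqVneq k l.
    have jkR := sub _ jk; have njl : j != l.
      by apply: contraNneq njk => jl; rewrite -jl in kl; rewrite (po_anti jkR kl).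
    have /patternP := pattern_conj (elem_ut kl) nQ (elem_ut_pattern jkR jk).
    (* Comparing entries of g(g^-1 x g) = xg avoids computing an inverse; the (j, l) entry of the
       conjugate comes out as 1. *)
    apply; have : (elem_ut kl * (elem_ut jkR ^ elem_ut kl) = elem_ut jkR * elem_ut kl)%g.
      by rewrite conjgE mulKVg.
    move: (_ ^ _)%g => y e; have := ut_mulgE (elem_ut kl) y j l; rewrite e ut_mulgE.
    rewrite [X in _ = X -> _]sum_elem_utl // (negPf njk) mul0r addr0.
    move=> <-; rewrite sum_elem_utr // !elem_utE !eqxx (negPf njl) orbT mulr1.
    by rewrite andTb [l == k]eq_sym (negPf nkl) add0r oner_neq0.
  split=> [i j|i j k l ij jk njk kl]; first exact: sub.
  have jl := trr _ _ _ jk njk kl; have [-> //|nij] := eqVneq i j.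
  have jlR := sub _ jl; have njl : j != l.
    by apply: contraNneq njk => ejl; rewrite -ejl in kl; rewrite (po_anti (sub _ jk) kl).
  have nil : i != l.
    by apply: contraNneq nij => eil; rewrite -eil in jlR; rewrite (po_anti ij jlR).
  have /patternP := pattern_conj (elem_ut ij)^-1%g nQ (elem_ut_pattern jlR jl).
  apply; have : ((elem_ut jlR ^ (elem_ut ij)^-1) * elem_ut ij = elem_ut ij * elem_ut jlR)%g.
    by rewrite conjgE invgK mulgA mulgKV.
  move: (_ ^ _)%g => y e; have := ut_mulgE y (elem_ut ij) i l; rewrite e ut_mulgE.
  rewrite [X in _ = X -> _]sum_elem_utr // [l == j]eq_sym (negPf njl) mulr0 addr0.
  move=> <-; rewrite sum_elem_utl // !elem_utE !eqxx (negPf nil) (negPf nij) orbT mulr1.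
  by rewrite andFb add0r oner_neq0.
move=> sub nrm; split; first by apply/subsetP => -[i j]; exact: sub.
rewrite /normal subsetT; apply/subsetP => g _; rewrite inE.
apply/subsetP => _ /imsetP[x /patternP xQ ->]; apply/patternP => i l.
apply: contraR => ilQ; apply/eqP; have nil : i != l.
  by apply: contraNneq ilQ => ->; exact: po_refl.
(* The (i, l) entry of g^-1 x g agrees term by term with that of g^-1 g, because only the diagonal
   of x contributes. *)
have : (g^-1 * g)%g (i, l) = 0 :> F by rewrite mulVg ffunE /= (negPf nil).
rewrite conjgE !ut_mulgE => g0; rewrite -[RHS]g0; apply: eq_bigr => j _.
rewrite ut_mulgE mulr_sumr (bigD1 j) //= ut1 mul1r big1 ?addr0 // => k kj.
have [ij|/(ut0 g^-1%g) ->] := boolP ((i, j) \in R); last by rewrite mul0r.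
have [kl|/(ut0 g) ->] := boolP ((k, l) \in R); last by rewrite !mulr0.
have [/xQ jk|] := boolP (x (j, k) != 0); last by rewrite negbK => /eqP ->; rewrite mul0r mulr0.
by case/negP: ilQ; apply: nrm ij jk _ kl; rewrite eq_sym.
Qed.
End NormalPattern.

Lemma NPtt_normal (F : finFieldType) (A : finType) (R : PO A) (N : {set UT F R}) :
  N \in NPtt F R <-> exists2 Q, normal_pair (Q, R) & N = pattern F R Q.
Proof.
split=> [/NPttP[Q [QR Qn ->]]|[Q]].
  by exists Q => //; rewrite -(normal_pattern F) QR.
by rewrite -(normal_pattern F) => /andP[QR Qn] ->; apply/NPttP; exists Q.
Qed.

(** * Moebius inversion and the basis of pattern subgroup indicators *)

Section Zeta.
Variables (I : finType) (K : fieldType) (le : rel I) (rank : I -> nat) (P : pred I).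
Hypothesis le_refl : reflexive le.
Hypothesis le_rank : forall x y, le x y -> x != y -> (rank x < rank y)%N.

(** The system is unitriangular with respect to [rank], so it is solved downward from the largest
    rank. *)
Lemma zeta_inj (G : I -> K) : (forall x, P x -> \sum_(y | P y && le x y) G y = 0) ->
  forall x, P x -> G x = 0.
Proof.
move=> G0 x; have [n] := ubnP (\max_y rank y - rank x)%N.
elim: n x => // n IHn x xn Px; have := G0 x Px.
rewrite (bigD1 x) ?Px ?le_refl //= big1 ?addr0 // => y /andP[/andP[Py xy] yx].
apply: IHn => //; have ltxy : (rank x < rank y)%N by rewrite le_rank // eq_sym.
apply: leq_trans (_ : (_ <= \max_y rank y - rank x)%N) _ => //.
by rewrite ltn_sub2l // (leq_trans ltxy) // leq_bigmax.
Qed.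

Lemma zeta_surj (g : I -> K) :
  exists G : I -> K, forall x, P x -> \sum_(y | P y && le x y) G y = g x.
Proof.
(* The equations are solved for the top [n] ranks: none when [n] is 0, all of them when [n] is
   [m.+1]. *)
set m := \max_y rank y; suff h n : exists G : I -> K, forall x, (m < rank x + n)%N -> P x ->
    \sum_(y | P y && le x y) G y = g x.
  by have [G GE] := h m.+1; exists G => x; apply: GE; rewrite leq_addl.
elim: n => [|n [G GE]].
  by exists (fun=> 0) => x; rewrite addn0 ltnNge leq_bigmax.
(* Values already found are kept; at the next rank the equation at x determines G x, whose
   coefficient is 1. *)
exists (fun x => if (m < rank x + n)%N then G x
                 else g x - \sum_(y | (P y && le x y) && (y != x)) G y) => x xn Px.
have big_rank y : le x y -> y != x -> (m < rank y + n)%N.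
  by move=> xy yx; apply: leq_trans xn _; rewrite addnS ltn_add2r le_rank // eq_sym.
have [xm|xm] := boolP (m < rank x + n)%N.
  rewrite -(GE x xm Px); apply: eq_bigr => y /andP[_ xy].
  by have [-> |yx] := eqVneq y x; rewrite ?xm // big_rank.
rewrite (bigD1 x) ?Px ?le_refl //= (negPf xm) [X in _ + X](eq_bigr G) ?subrK //.
by move=> y /andP[/andP[_ xy] yx]; rewrite big_rank.
Qed.
End Zeta.

Section PatternIndicators.
Variables (F : finFieldType) (K : fieldType) (A : finType) (R : PO A).

Lemma generic_subproof (Q : PO A) :
  is_UT R [ffun p : A * A => ((p \in Q) && (p \in R))%:R : F].
Proof.
apply/is_UTP; split=> [i|i j /negPf ij]; rewrite ffunE ?po_refl //.
by rewrite ij andbF.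
Qed.
(** A test point of [UT_Q]: all its entries on [Q] are nonzero, so for [Q] inside [R] it lies in
    [UT_Q'] only when [Q'] contains [Q]. *)
Definition generic Q : UT F R := MkUT (generic_subproof Q).

Lemma generic_pattern (Q Q' : PO A) : Q \subset R ->
  (generic Q \in pattern F R Q') = (Q \subset Q').
Proof.
move=> /subsetP QR; apply/patternP/subsetP => [h [i j] ij|h i j].
  by apply: h; rewrite ffunE ij QR // oner_neq0.
by rewrite ffunE; case: (boolP ((i, j) \in Q)) => [/h //|_]; rewrite eqxx.
Qed.

Lemma proper_card_PO (Q Q' : PO A) : Q \subset Q' -> Q != Q' -> (#|Q| < #|Q'|)%N.
Proof.
by move=> QQ' nQ; apply: proper_card; rewrite properEneq QQ' andbT.
Qed.

(** Linear independence of the indicators: evaluating at [generic Q] leaves the sum over the normal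
    orders containing [Q], which [zeta_inj] inverts. *)
Lemma pattern_sum_inj (G : PO A -> K) :
  (forall u : UT F R, \sum_(Q | normal_pair (Q, R) && (u \in pattern F R Q)) G Q = 0) ->
  forall Q, normal_pair (Q, R) -> G Q = 0.
Proof.
move=> G0; apply: (zeta_inj (le := fun Q Q' : PO A => Q \subset Q') (rank := fun Q : PO A => #|Q|)).
- by move=> Q; exact: subxx.
- exact: proper_card_PO.
move=> Q /normal_pairP[QR _]; rewrite -[RHS](G0 (generic Q)); apply: eq_bigl => Q'.
by rewrite generic_pattern //; apply/subsetP => -[i j]; exact: QR.
Qed.

(** The indicators span: every block of [Cl] contains a generic point, so it suffices to match [phi]
    at those. *)
Lemma pattern_sum_surj (phi : {ffun UT F R -> K}) : constant_on_Cl phi ->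
  exists G : PO A -> K, forall u,
    \sum_(Q | normal_pair (Q, R) && (u \in pattern F R Q)) G Q = phi u.
Proof.
move=> /constant_on_ClP phiP; have [G GE] := zeta_surj (I := PO A) (K := K)
  (le := fun Q Q' => Q \subset Q') (rank := fun Q => #|Q|) (fun Q => normal_pair (Q, R))
  (fun Q => subxx _) proper_card_PO (fun Q => phi (generic Q)).
exists G => u; have [N [NN uN _]] := core_exists u.
have [Q Qn NQ] := (NPtt_normal N).1 NN.
have QR : Q \subset R.
  by have /normal_pairP[h _] := Qn; apply/subsetP => -[i j]; exact: h.
(* As [UT_Q] is the smallest normal pattern subgroup containing u, its generic point lies in the
   same block as u. *)
have uM M : M \in NPtt F R -> (generic Q \in M) = (u \in M).
  move=> MN; have [Q' _ MQ'] := (NPtt_normal M).1 MN.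
  apply/idP/idP => [|/(core_sub uN NN MN)/subsetP]; last first.
    by apply; rewrite NQ generic_pattern.
  rewrite MQ' generic_pattern // => /subsetP QQ'; apply/patternP => i j uij.
  apply: QQ'; move: uN; rewrite inE NQ => /andP[/patternP + _]; exact.
rewrite (phiP u (generic Q) uM) -(GE Q Qn); apply: eq_bigl => Q'.
case: (boolP (normal_pair _)) => //= nQ'; rewrite -(generic_pattern Q' QR) uM //.
by apply/NPtt_normal; exists Q'.
Qed.
End PatternIndicators.

(** * Coordinates on tensors *)

Definition atomic (A : finType) (p : PO A * PO A) : bool :=
  normal_pair p && indec_on [set: A] p.1.

Lemma atomic_pull (A B : finType) (f : A -> B) (fI : injective f) p :
  bijective f -> atomic (pair_pull fI p) = atomic p.
Proof.
move=> fB; rewrite /atomic normal_pull_bij // indec_on_pull; congr (_ && indec_on _ _).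
apply/setP => b; rewrite inE; have [g fK gK] := fB.
by apply/imsetP; exists (g b); rewrite ?inE ?gK.
Qed.

Definition atom (A : finType) : finType := {p : PO A * PO A | atomic p}.

Section AtomSpecies.
Variable K : fieldType.

Definition atoms_obj (A : finType) : lmodType K := {ffun atom A -> K^o}.

Section Value.
Variables (A : finType) (p : PO A * PO A).

(** The coordinate at [p], extended by 0 to pairs that are not atomic so that no proof of atomicity
    has to be carried along. *)
Definition value (v : atoms_obj A) : K^o := if insub p is Some x then v x else 0.
Lemma value_linear : linear value.
Proof.
move=> a v w; rewrite /value; case: insubP => [x _ _|_]; first by rewrite !ffunE.
by rewrite scaler0 addr0.
Qed.
HB.instance Definition _ :=
  GRing.isLinear.Build K (atoms_obj A) K^o _ value value_linear.

Lemma value_atom v (x : atom A) : val x = p -> value v = v x.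
Proof. by move=> xp; rewrite /value -xp valK. Qed.
Lemma value0 v : ~~ atomic p -> value v = 0.
Proof. by move=> np; rewrite /value insubN. Qed.
End Value.

Section Map.
Variables (A B : finType) (f : bij A B).
Let fI := bij_inj (bij_bijective f).

Definition atoms_map_fun (v : atoms_obj A) : atoms_obj B :=
  [ffun x => value (pair_pull fI (val x)) v].
Lemma atoms_map_linear : linear atoms_map_fun.
Proof. by move=> a v w; apply/ffunP => x; rewrite !ffunE linearP. Qed.
HB.instance Definition _ := GRing.isLinear.Build K (atoms_obj A) (atoms_obj B) _
  atoms_map_fun atoms_map_linear.
Definition atoms_map : {linear atoms_obj A -> atoms_obj B} := atoms_map_fun.

Lemma value_map p v : value p (atoms_map v) = value (pair_pull fI p) v.
Proof.
rewrite {1}/value; case: insubP => [x _ <-|np]; first by rewrite ffunE.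
by rewrite value0 // atomic_pull //; exact: bij_bijective.
Qed.
End Map.

Lemma value_eq (A : finType) (v w : atoms_obj A) :
  (forall p, value p v = value p w) -> v = w.
Proof. by move=> vw; apply/ffunP => x; have := vw (val x); rewrite !(value_atom _ erefl). Qed.

Lemma atoms_id (A : finType) (v : atoms_obj A) : atoms_map (bij_id A) v = v.
Proof.
apply: value_eq => p; rewrite value_map; congr value.
by apply: pair_eq => i j; rewrite !po_pullE.
Qed.
Lemma atoms_comp (A B C : finType) (g : bij B C) (f : bij A B) (v : atoms_obj A) :
  atoms_map (bij_comp g f) v = atoms_map g (atoms_map f v).
Proof.
apply: value_eq => p; rewrite !value_map; congr value.
by apply: pair_eq => i j; rewrite !po_pullE.
Qed.
Definition atoms : species K := Species atoms_id atoms_comp.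
End AtomSpecies.

Section TensorForms.
Variables (K : fieldType) (V W : lmodType K).

Section Product.
Variables (f : {linear V -> K^o}) (g : {linear W -> K^o}).
Let linl w : linear (fun v => (f v : K) * g w : K^o).
Proof. by move=> a v v'; rewrite linearP mulrDl scalerAl. Qed.
Let linr v : linear (fun w => (f v : K) * g w : K^o).
Proof. by move=> a w w'; rewrite linearP mulrDr scalerAr. Qed.
Definition form_tens_fun : tens V W -> K^o :=
  TensorProduct.tens_lift (fun v w => (f v : K) * g w : K^o).
HB.instance Definition _ := GRing.isLinear.Build K (tens V W) K^o _ form_tens_fun
  (TensorProduct.tens_lift_linear linl linr).
Definition form_tens : {linear tens V W -> K^o} := form_tens_fun.
Lemma form_tensE v w : form_tens (pure v w) = (f v : K) * g w.
Proof. exact: TensorProduct.tens_liftE linl linr v w. Qed.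
End Product.

Section Contraction.
Variable f : {linear V -> K^o}.
Let linl w : linear (fun v => (f v : K) *: (w : W)).
Proof. by move=> a v v'; rewrite linearP scalerDl scalerA. Qed.
Let linr v : linear (fun w : W => (f v : K) *: w).
Proof. by move=> a w w'; rewrite scalerDr !scalerA mulrC. Qed.
Definition contract_fun : tens V W -> W :=
  TensorProduct.tens_lift (fun v w => (f v : K) *: w).
HB.instance Definition _ := GRing.isLinear.Build K (tens V W) W _ contract_fun
  (TensorProduct.tens_lift_linear linl linr).
Definition contract : {linear tens V W -> W} := contract_fun.
Lemma contractE v w : contract (pure v w) = (f v : K) *: w.
Proof. exact: TensorProduct.tens_liftE linl linr v w. Qed.
End Contraction.

Lemma pure_suml (I : Type) (r : seq I) (a : I -> K) (v : I -> V) (w : W) :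
  pure (\sum_(i <- r) a i *: v i) w = \sum_(i <- r) pure (v i) (a i *: w).
Proof.
have pureZl b (x : V) : pure (b *: x) w = pure x (b *: w).
  (* Linearity in the form f(ax + y) with a = -1 and y = x shows that pure tensors with a zero
     factor vanish. *)
  have := TensorProduct.pure_linr x b w 0; have := TensorProduct.pure_linl w b x 0.
  have := TensorProduct.pure_linl w (-1) x x; have := TensorProduct.pure_linr x (-1) w w.
  by rewrite !scaleN1r !addNr !addr0 => -> -> -> ->.
elim: r => [|i r IHr].
  by rewrite !big_nil; have := pureZl 0 0; rewrite !scale0r => ->;
    have := TensorProduct.pure_linr (0 : V) (-1) w w; rewrite !scaleN1r !addNr.
rewrite !big_cons -IHr -pureZl.
by have := TensorProduct.pure_linl w 1 (a i *: v i) (\sum_(i <- r) a i *: v i); rewrite !scale1r.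
Qed.
End TensorForms.
Arguments contract {K V W} f.

Section Coordinates.
Variables (K : fieldType) (A : finType).
Local Notation q := (atoms K).
Local Notation family := (forall S : {set A}, PO (sub S) * PO (sub S)).
Implicit Types (r : family) (s t : seq {set A}).

(** The product of the coordinate forms at [r S] over the blocks [S] of [s]. A family on all subsets
    spares an index type depending on [s]; only its values on members of [s] matter. *)
Fixpoint coord r s : {linear tensor q s -> K^o} :=
  match s return {linear tensor q s -> K^o} with
  | [::] => idfun
  | X :: s' => form_tens (value (r X)) (coord r s')
  end.

Lemma coord_cons r S s v x :
  coord r (S :: s) (pure v x) = (value (r S) v : K) * coord r s x.
Proof. exact: form_tensE. Qed.

Lemma eq_coord r r' s (x : tensor q s) :
  (forall S, S \in s -> r S = r' S) -> coord r s x = coord r' s x.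
Proof.
elim: s x => // S s IHs x rr'; apply: tens_ext => v {}x.
by rewrite !coord_cons rr' ?mem_head // IHs // => T Ts; rewrite rr' // inE Ts orbT.
Qed.

Lemma coord_tcat r s t (x : tensor q s) (y : tensor q t) :
  coord r (s ++ t) (tcat s y x) = (coord r s x : K) * coord r t y.
Proof.
elim: s x => [|S s IHs] x; first by rewrite /= /scale_by linearZ.
apply: (tens_ext (f := coord r (S :: s ++ t) \o tcat (S :: s) y)
  (g := scale_by (coord r t y) \o coord r (S :: s))) => v {}x.
by rewrite /= tens_mapE /scale_by !form_tensE IHs mulrA.
Qed.

Definition delta (B : finType) (p : PO B * PO B) : q B := [ffun x => (val x == p)%:R].

Lemma value_delta (B : finType) (p p' : PO B * PO B) :
  value p (delta p') = (atomic p && (p == p'))%:R.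
Proof.
rewrite /value; case: insubP => [x -> <-|/negPf-> //]; by rewrite ffunE.
Qed.

Fixpoint basis r s : tensor q s :=
  match s return tensor q s with
  | [::] => (1 : K)
  | X :: s' => pure (delta (r X)) (basis r s')
  end.

Lemma coord_basis r r' s : (forall S, S \in s -> atomic (r S)) ->
  coord r s (basis r' s) = (all (fun S => r S == r' S) s)%:R.
Proof.
elim: s => // S s IHs ra; rewrite [LHS]coord_cons IHs => [|T Ts]; last first.
  by rewrite ra // inE Ts orbT.
by rewrite value_delta ra ?mem_head //= -natrM mulnb.
Qed.

(** Expansion of a tensor along the basis of its first factor, the coefficients being tensors in the
    remaining factors. *)
Lemma contract_sum S s (x : tensor q (S :: s)) :
  x = \sum_(p : atom (sub S)) pure (delta (val p)) (contract (value (val p)) x).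
Proof.
move: x; apply: (TensorProduct.tens_ind (P := fun x => x = \sum_(p : atom (sub S))
  pure (delta (val p)) (contract (value (val p)) x))).
  rewrite big1 // => p _; rewrite linear0.
  have := TensorProduct.pure_linr (delta (val p)) (-1) (0 : tensor q s) 0.
  by rewrite !scaleN1r !addNr.
move=> a v w x {1}->; under [RHS]eq_bigr do rewrite linearP TensorProduct.pure_linr.
rewrite big_split -scaler_sumr /=; congr (_ *: _ + _).
under eq_bigr do rewrite contractE.
rewrite -pure_suml; congr (pure _ w); apply/ffunP => y; rewrite sum_ffunE.
rewrite (bigD1 y) //= !ffunE (value_atom _ erefl) eqxx [_ *: _]mulr1 big1 ?addr0 // => z zy.
by rewrite !ffunE (inj_eq val_inj) eq_sym (negPf zy) [LHS]mulr0.
Qed.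

Lemma coord_contract r S s (p : atom (sub S)) (x : tensor q (S :: s)) :
  r S = val p -> coord r (S :: s) x = coord r s (contract (value (val p)) x).
Proof.
move=> rS; apply: (tens_ext (f := coord r (S :: s)) (g := coord r s \o contract (value (val p)))).
by move=> v {}x; rewrite coord_cons /= contractE linearZ rS.
Qed.

(** By induction, all coefficients of the expansion along the first factor vanish. The family [r0]
    provides a form to evaluate when [s] is empty. *)
Lemma coord_inj s (x : tensor q s) r0 : uniq s ->
  (forall r, (forall S, S \in s -> atomic (r S)) -> coord r s x = 0) -> x = 0.
Proof.
elim: s x => [|S s IHs] x; first by move=> _ /(_ r0); apply.
move=> /= /andP[Ss su] x0; rewrite (contract_sum x) big1 // => p _.
have -> : contract (value (val p)) x = 0.
  apply: IHs => // r ra.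
  (* The family [r] with its value at [S] replaced by the atom p; since [S] is not repeated in [s],
     nothing changes on [s]. *)
  pose r' T : PO (sub T) * PO (sub T) :=
    if eqVneq S T is EqNotNeq e then ecast T (PO (sub T) * PO (sub T))%type e (val p) else r T.
  have r'S : r' S = val p.
    by rewrite /r'; case: eqVneq => [e|]; rewrite ?eqxx // (eq_irrelevance e erefl).
  have r'r T : T \in s -> r' T = r T.
    by rewrite /r'; case: eqVneq => // e Ts; rewrite e Ts in Ss.
  rewrite -(eq_coord _ r'r) -coord_contract //; apply: x0 => T.
  rewrite inE; case: eqVneq => [-> _|_ /= Ts]; first by rewrite r'S (valP p).
  by rewrite r'r ?ra.
have := TensorProduct.pure_linr (delta (val p)) (-1) (0 : tensor q s) 0.
by rewrite !scaleN1r !addNr.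
Qed.
End Coordinates.
Arguments coord {K A} r s.
Arguments basis {K A} r s.

Section CoordImage.
Variables (K : fieldType) (A B : finType) (f : A -> B) (fI : injective f).
Variable r : forall S : {set B}, PO (sub S) * PO (sub S).

Definition family_pull (S : {set A}) : PO (sub S) * PO (sub S) :=
  pair_pull (bij_inj (bij_bijective (im_bij fI S))) (r (f @: S)).

Lemma coord_tim (s : seq {set A}) (x : tensor (atoms K) s) :
  coord r _ (tim (atoms K) fI s x) = coord family_pull s x.
Proof.
elim: s x => // S s IHs x.
apply: (tens_ext (f := coord r (f @: S :: [seq f @: X | X : {set A} <- s])
    \o tim (atoms K) fI (S :: s)) (g := coord family_pull (S :: s))) => v {}x.
rewrite [RHS]coord_cons /= tens_mapE form_tensE IHs; congr (_ * _); exact: value_map.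
Qed.
End CoordImage.

(** * Gluing along a composition *)

Section Restriction.
Variables (A : finType) (S : {set A}).

Lemma sub_inj : injective (fun x : sub S => sval x).
Proof. by move=> x y; exact: val_inj. Qed.

Lemma sub_im : [set sval x | x in [set: sub S]] = S.
Proof.
apply/setP => a; apply/imsetP/idP => [[[b bS] _ ->] //|aS].
by exists (exist _ a aS).
Qed.

Definition restr (p : PO A * PO A) : PO (sub S) * PO (sub S) := pair_pull sub_inj p.

Lemma atomic_restr p : atomic (restr p) = normal_pair (restr p) && indec_on S p.1.
Proof. by rewrite /atomic indec_on_pull sub_im. Qed.
End Restriction.

Section Blocks.
Variables (A : finType) (c : comp A).
Local Notation block_of a := (find (fun S : {set A} => a \in S) c).

Lemma find_block S a : S \in (c : seq _) -> a \in S -> block_of a = index S c.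
Proof.
have /and3P[_ cd _] := comp_seqP c; move: cd; elim: (comp_seq c) => //= X s IHs.
move=> /andP[/allP Xd sd]; rewrite inE => /orP[/eqP ->|Ss] aS.
  by rewrite aS eqxx.
have /disjointP d := Xd S Ss.
case: (boolP (a \in X)) => [/d /(_ aS)//|aX].
have [XS|_] := eqVneq X S; last by rewrite IHs.
by rewrite -XS (negPf aX) in aS.
Qed.

Lemma block_uniq S T a : S \in (c : seq _) -> T \in (c : seq _) ->
  a \in S -> a \in T -> S = T.
Proof.
move=> Sc Tc aS aT; rewrite -(nth_index set0 Sc) -(nth_index set0 Tc).
by rewrite -(find_block Sc aS) -(find_block Tc aT).
Qed.

Lemma comp_uniq : uniq c.
Proof.
have /and3P[c0 cd _] := comp_seqP c; move: c0 cd; elim: (comp_seq c) => //= X s IHs.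
move=> /andP[X0 s0] /andP[/allP Xd sd]; rewrite IHs // andbT; apply/negP => /Xd.
by rewrite -setI_eq0 setIid (negPf X0).
Qed.

Lemma block_mem a : exists2 S, S \in (c : seq _) & a \in S.
Proof. by have /is_compP[_ _] := comp_seqP c; exact. Qed.

Lemma same_block a b : block_of a = block_of b ->
  exists2 S, S \in (c : seq _) & a \in S /\ b \in S.
Proof.
have [S Sc aS] := block_mem a; have [T Tc bT] := block_mem b.
rewrite (find_block Sc aS) (find_block Tc bT) => e; exists S => //; split=> //.
by rewrite -(nth_index set0 Sc) e nth_index.
Qed.

Definition ordered (Q : {set A * A}) : Prop :=
  forall a b, (block_of a < block_of b)%N -> (a, b) \in Q.

Lemma orderedP (Q : {set A * A}) :
  reflect (ordered Q) (pairwise (fun S T : {set A} => setX S T \subset Q) c).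
Proof.
apply: (iffP (pairwiseP set0)) => [h a b|h i j ic jc ij].
  have [S Sc aS] := block_mem a; have [T Tc bT] := block_mem b.
  rewrite (find_block Sc aS) (find_block Tc bT) => /h.
  rewrite !inE !index_mem !nth_index // => /(_ Sc Tc)/subsetP/(_ (a, b)).
  by rewrite in_setX aS bT; exact.
apply/subsetP => -[a b]; rewrite in_setX => /andP[aS bT]; apply: h.
rewrite (find_block (mem_nth _ ic) aS) (find_block (mem_nth _ jc) bT).
by rewrite !index_uniq ?comp_uniq.
Qed.

Section OrderedOrders.
Variables (Q R : PO A).
Hypothesis (Qo : ordered Q) (QR : Q \subset R).

Lemma ordered_le i j : (i, j) \in R -> (block_of i <= block_of j)%N.
Proof.
move=> ij; rewrite leqNgt; apply/negP => ji.
by have := ji; rewrite (po_anti ij (subsetP QR _ (Qo ji))) ltnn.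
Qed.

(** If i lies in an earlier block than l, the relation holds because [Q] is ordered along [c].
    Otherwise the weakly increasing block numbers force i, j, k, l into one block, where normality
    is assumed. *)
Lemma ordered_restr :
  (forall S, S \in (c : seq _) -> normal_pair (restr S (Q, R))) -> normal_pair (Q, R).
Proof.
move=> nS; apply/normal_pairP; split=> [i j|i j k l] /=; first exact: (subsetP QR).
move=> ij jk njk kl; have ijb := ordered_le ij; have klb := ordered_le kl.
have jkb := ordered_le (subsetP QR _ jk).
have [il|li] := ltnP (block_of i) (block_of l); first exact: Qo.
have [eij ejk] : block_of i = block_of j /\ block_of j = block_of k.
  by split; apply/eqP; rewrite eqn_leq ?ijb ?jkb /= ?(leq_trans jkb) ?(leq_trans klb) // (leq_trans li).
have ekl : block_of k = block_of l.
  by apply/eqP; rewrite eqn_leq klb (leq_trans li) // eij ejk.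
have [S Sc [iS jS]] := same_block eij; have [T Tc [kT lT]] := same_block ekl.
have [U Uc [jU kU]] := same_block ejk.
have TS : T = S by rewrite (block_uniq Tc Uc kT kU) (block_uniq Uc Sc jU jS).
rewrite TS in kT lT; have /normal_pairP[_ n] := nS S Sc.
have := n (exist _ i iS) (exist _ j jS) (exist _ k kT) (exist _ l lT).
rewrite !po_pullE /=; apply=> //.
Qed.
End OrderedOrders.

(** Any order containing [p.1] compares elements of different blocks exactly by block number, so
    only the restrictions to the blocks are free. *)
Lemma restr_inj (p p' : PO A * PO A) : ordered p.1 -> ordered p'.1 ->
  p.1 \subset p.2 -> p'.1 \subset p'.2 ->
  (forall S, S \in (c : seq _) -> restr S p = restr S p') -> p = p'.
Proof.
move=> po p'o ps p's e.
have key (O O' : PO A) : p.1 \subset O -> p'.1 \subset O' ->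
    (forall S, S \in (c : seq _) -> po_pull (@sub_inj A S) O = po_pull (@sub_inj A S) O') ->
    forall i j, ((i, j) \in O) = ((i, j) \in O').
  move=> pO p'O' eO i j; have [ij|ji|/same_block[S Sc [iS jS]]] := ltngtP (block_of i) (block_of j).
  - by rewrite (subsetP pO) ?(subsetP p'O') //; [exact: p'o | exact: po].
  - by apply/idP/idP => /ordered_le h; [have := h _ po pO | have := h _ p'o p'O'];
      rewrite leqNgt ji.
  have E (O'' : PO A) : ((i, j) \in O'') =
      ((exist _ i iS, exist _ j jS) \in po_pull (@sub_inj A S) O'') by rewrite po_pullE.
  by rewrite E [RHS]E eO.
apply: pair_eq; apply: key => // S Sc.
  exact: (congr1 fst (e S Sc)).
exact: (congr1 snd (e S Sc)).
Qed.

Section Glue.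
Variable r : forall S : {set A}, PO (sub S).

(* The lexicographic order: first by block, then by r inside a block. *)
Definition glue_rel : {set A * A} :=
  [set p | (block_of p.1 < block_of p.2)%N || has (fun S => [exists x : sub S,
     exists y : sub S, [&& sval x == p.1, sval y == p.2 & (x, y) \in r S]]) c].

Lemma glue_relE S (x y : sub S) : S \in (c : seq _) ->
  ((sval x, sval y) \in glue_rel) = ((x, y) \in r S).
Proof.
move=> Sc; rewrite inE /= (find_block Sc (valP x)) (find_block Sc (valP y)) ltnn /=.
apply/hasP/idP => [[T Tc]|xy]; last first.
  by exists S => //; apply/existsP; exists x; apply/existsP; exists y; rewrite !eqxx.
move=> /existsP[x' /existsP[y' /and3P[/eqP xx' /eqP yy']]].
have xT : sval x \in T by rewrite -xx'; exact: (valP x').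
have ST : S = T by apply: block_uniq (valP x) xT.
case: _ / ST x' y' xx' yy' xT => x' y' xx' yy' _.
by rewrite (sub_inj xx') (sub_inj yy').
Qed.

Lemma glue_lt i j : (block_of i < block_of j)%N -> (i, j) \in glue_rel.
Proof. by rewrite inE /= => ->. Qed.

Lemma glue_le i j : (i, j) \in glue_rel -> (block_of i <= block_of j)%N.
Proof.
rewrite inE /= => /orP[/ltnW //|/hasP[S Sc]].
move=> /existsP[x /existsP[y /and3P[/eqP <- /eqP <- _]]].
by rewrite (find_block Sc (valP x)) (find_block Sc (valP y)).
Qed.

Lemma glue_block i j : block_of i = block_of j -> exists2 S, S \in (c : seq _) &
  exists x y : sub S, i = sval x /\ j = sval y.
Proof.
move=> /same_block[S Sc [iS jS]]; exists S => //.
by exists (exist _ i iS), (exist _ j jS).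
Qed.

Lemma glue_subproof : is_order glue_rel.
Proof.
apply/is_orderP; split=> [i|i j ij ji|i j k ij jk].
- have [S Sc [x [_ [-> _]]]] := glue_block (erefl (block_of i)).
  by rewrite glue_relE // po_refl.
- have e : block_of i = block_of j by apply/eqP; rewrite eqn_leq !glue_le.
  have [S Sc [x [y [ix jy]]]] := glue_block e; move: ij ji; rewrite ix jy !glue_relE //.
  by move=> xy yx; rewrite (po_anti xy yx).
have [ij' jk'] := (glue_le ij, glue_le jk).
have [lt|] := ltnP (block_of i) (block_of k); first exact: glue_lt.
move=> ki; have eij : block_of i = block_of j.
  by apply/eqP; rewrite eqn_leq ij' (leq_trans jk').
have ejk : block_of j = block_of k by apply/eqP; rewrite eqn_leq jk' -eij.
have [S Sc [iS jS]] := same_block eij; have [T Tc [jT kT]] := same_block ejk.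
have kS : k \in S by rewrite (block_uniq Sc Tc jS jT).
pose x : sub S := exist _ i iS; pose y : sub S := exist _ j jS; pose z : sub S := exist _ k kS.
rewrite (glue_relE x z Sc); apply: po_trans (_ : (x, y) \in r S) (_ : (y, z) \in r S).
  by rewrite -(glue_relE x y Sc).
by rewrite -(glue_relE y z Sc).
Qed.
Definition glue : PO A := MkPO glue_subproof.

Lemma glue_restr S : S \in (c : seq _) -> po_pull (@sub_inj A S) glue = r S.
Proof. by move=> Sc; apply: po_eq => x y; rewrite po_pullE glue_relE. Qed.
End Glue.

(** Inverse to factoring a pair: both orders are glued lexicographically, so they agree across
    blocks and the inclusion and normality reduce to single blocks. *)
Lemma glue_pair (r : forall S : {set A}, PO (sub S) * PO (sub S)) :
  (forall S, S \in (c : seq _) -> atomic (r S)) ->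
  exists p, [/\ normal_pair p, good c p.1 &
    forall S, S \in (c : seq _) -> restr S p = r S].
Proof.
move=> ra; pose Q := glue (fun S => (r S).1); pose R := glue (fun S => (r S).2).
have rS S : S \in (c : seq _) -> restr S (Q, R) = r S.
  by move=> Sc; rewrite /restr /pair_pull !glue_restr //; case: (r S).
have Qo : ordered Q by move=> a b; exact: glue_lt.
have QR : Q \subset R.
  apply/subsetP => -[i j] ij; have := glue_le ij; rewrite leq_eqVlt => /orP[/eqP|]; last first.
    exact: glue_lt.
  move=> /glue_block[S Sc [x [y [ix jy]]]]; rewrite ix jy glue_relE // in ij *.
  by have /andP[/normal_pairP[sub _] _] := ra S Sc; rewrite glue_relE //; exact: sub.
have nQR : normal_pair (Q, R).
  by apply: ordered_restr => // S Sc; rewrite rS //; have /andP[] := ra S Sc.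
exists (Q, R); split=> //; apply/andP; split; first exact/orderedP.
by apply/allP => S Sc; have := ra S Sc; rewrite -(rS S Sc) atomic_restr => /andP[].
Qed.
End Blocks.

Lemma good_atomic (A : finType) (c : comp A) (p : PO A * PO A) S :
  normal_pair p -> good c p.1 -> S \in (c : seq _) -> atomic (restr S p).
Proof. by move=> pn /andP[_ /allP h] Sc; rewrite atomic_restr normal_pull // h. Qed.

(** * Coordinates on the free monoid, indexed by normal pairs *)

Section TotalCoordinates.
Variable K : fieldType.
Local Notation q := (atoms K).
Local Notation free := (free_obj q).

(* Exactly one composition is good for p.1, so this is the coefficient of x at p. *)
Definition weight (A : finType) (x : free A) (p : PO A * PO A) : K :=
  \sum_(c : comp A | good c p.1) coord (fun S => restr S p) c (x c).

Lemma weight_linear A a (x y : free A) p :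
  weight (a *: x + y) p = a * weight x p + weight y p.
Proof.
rewrite /weight mulr_sumr -big_split; apply: eq_bigr => c _ /=.
by rewrite dsumDE dsumZE linearP.
Qed.

Lemma weight_good A (x : free A) p (c : comp A) : good c p.1 ->
  weight x p = coord (fun S => restr S p) c (x c).
Proof.
move=> cp; rewrite /weight (bigD1 c) //= big1 ?addr0 // => d /andP[dp].
by rewrite (good_uniq dp cp) eqxx.
Qed.

(** By [glue_pair], each family of atoms on the blocks of a composition comes from a normal pair, so
    every coordinate of every component of [x] is a weight. *)
Lemma weight_inj A (x : free A) :
  (forall p, normal_pair p -> weight x p = 0) -> x = 0.
Proof.
move=> x0; apply: dsumP => c; rewrite dsum0E.
(* An arbitrary default family, made of discrete orders. *)
have r0 (S : {set A}) : PO (sub S) * PO (sub S).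
  suff o : PO (sub S) by exact: (o, o).
  exists [set p : sub S * sub S | p.1 == p.2].
  by apply/is_orderP; split=> [i|i j|i j k]; rewrite !inE //= => /eqP ->.
apply: (coord_inj r0 (comp_uniq c)) => r ra.
have [p [pn cp pr]] := glue_pair ra; rewrite -(x0 p pn) (weight_good x cp).
by apply: eq_coord => S Sc; rewrite pr.
Qed.

(** The basis tensors attached to the normal pairs are dual to the weights: distinct pairs with the
    same composition differ on some block by [restr_inj]. *)
Lemma weight_surj A (G : PO A * PO A -> K) :
  exists x : free A, forall p, normal_pair p -> weight x p = G p.
Proof.
exists (fun c : comp A =>
  \sum_(p | normal_pair p && good c p.1) (G p : K) *: basis (K := K) (fun S => restr S p) c).
move=> p pn; have [c cp] := good_exists p.1; rewrite (weight_good _ cp) linear_sum /=.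
have ca S := good_atomic pn cp (S := S).
rewrite (bigD1 p) ?pn //= linearZ coord_basis //.
rewrite (_ : all _ c) /=; last by apply/allP => S _; rewrite eqxx.
rewrite [_ *: _]mulr1 big1 ?addr0 // => p' /andP[/andP[p'n cp'] pp'].
rewrite linearZ coord_basis //; case: allP => [e|_]; last exact: mulr0.
case/eqP: pp'; apply: (restr_inj (c := c)).
- by apply/orderedP; case/andP: cp'.
- by apply/orderedP; case/andP: cp.
- by have /normal_pairP[h _] := p'n; apply/subsetP => -[i j]; exact: h.
- by have /normal_pairP[h _] := pn; apply/subsetP => -[i j]; exact: h.
by move=> S /e /eqP.
Qed.

Lemma coord_teq (A : finType) r (s t : seq {set A}) (x : tensor q s) (y : tensor q t) :
  teq x y -> coord r s x = coord r t y.
Proof. by case=> e; case: _ / e y => y <-. Qed.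

Lemma weight_map (A B : finType) (f : bij A B) (x : free A) p :
  weight (free_map q f x) p = weight x (pair_pull (bij_inj (bij_bijective f)) p).
Proof.
have fI := bij_inj (bij_bijective f); have [g fK gK] := bij_bijective f.
pose h : bij B A := Bij (Bijective gK fK).
rewrite /weight [RHS](reindex (comp_pull f)); last first.
  exists (comp_pull h) => c _.
    apply: comp_pull_im; first exact: can_inj gK.
    rewrite -[in RHS](im_comp_pull f c) -map_comp -[LHS]map_id; apply: eq_map => X /=.
    by rewrite -imset_comp -[LHS]imset_id; apply: eq_imset => z /=; rewrite fK.
  apply: comp_pull_im => //.
  rewrite -[in RHS](im_comp_pull h c) -map_comp -[LHS]map_id; apply: eq_map => X /=.
  by rewrite -imset_comp -[LHS]imset_id; apply: eq_imset => z /=; rewrite gK.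
apply: eq_big => [d|d _]; first by rewrite -good_im im_comp_pull.
have e := esym (im_comp_pull f d).
rewrite (coord_teq _ (free_mapE fI x e)) coord_tim; apply: eq_coord => S _.
by apply: pair_eq => i j; rewrite !po_pullE.
Qed.

Definition is_dot (A B : finType) (R : PO (A + B)%type) : bool :=
  R == po_dot (po_pull (@inl_inj A B) R) (po_pull (@inr_inj A B) R).

(** Since the blocks cover [A] and [B], placing every block of [a] below every block of [b] amounts
    to [Q] being an ordinal sum. *)
Lemma good_dot (A B : finType) (a : comp A) (b : comp B) (Q : PO (A + B)%type) :
  good (comp_dot a b) Q =
  [&& is_dot Q, good a (po_pull (@inl_inj A B) Q) & good b (po_pull (@inr_inj A B) Q)].
Proof.
rewrite -!good_im /good /= /dot_seq pairwise_cat all_cat.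
set al := allrel _ _ _; have -> : is_dot Q = al.
  apply/po_dotP/allrelP => [h _ _ /mapP[S _ ->] /mapP[T _ ->]|h x y].
    apply/subsetP => -[a' b']; rewrite in_setX => /andP[/imsetP[x _ ->] /imsetP[y _ ->]].
    by have /andP[] := h x y.
  have [S Sa xS] := block_mem a x; have [T Tb yT] := block_mem b y.
  have /subsetP xy := h _ _ (map_f (fun X : {set A} => inl @: X) Sa)
    (map_f (fun X : {set B} => inr @: X) Tb).
  have {}xy : (inl x, inr y) \in Q by apply: xy; rewrite in_setX !imset_f.
  by rewrite xy; apply/negP => yx; have := po_anti xy yx.
by rewrite !andbA; case: al => //=; rewrite -!andbA; congr (_ && _); rewrite andbCA.
Qed.

(** Components at compositions that are not concatenations vanish. The others are indexed by pairs
    (a, b), and the double sum factors. *)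
Lemma weight_mul (A B : finType) (x : free A) (y : free B) p :
  weight (free_mul x y) p =
    if is_dot p.1 then weight x (pair_pull (@inl_inj A B) p) * weight y (pair_pull (@inr_inj A B) p)
    else 0.
Proof.
have [lI rI] := (@inl_inj A B, @inr_inj A B).
pose dotP (c : comp (A + B)%type) := comp_dot (comp_pull inl c) (comp_pull inr c) == c.
rewrite /weight (bigID dotP) /= [X in _ + X]big1 ?addr0 => [|c /andP[_ nc]]; last first.
  rewrite free_mul0 ?linear0 // => a b e; case/eqP: nc; apply: comp_eq.
  by rewrite (comp_pull_dotl e) (comp_pull_dotr e).
rewrite (reindex_onto (fun ab : comp A * comp B => comp_dot ab.1 ab.2)
  (fun c => (comp_pull inl c, comp_pull inr c))) => [|c /andP[_ /eqP //]].
have pulls (a : comp A) (b : comp B) :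
    (comp_pull inl (comp_dot a b) = a) * (comp_pull inr (comp_dot a b) = b).
  by split; [exact: comp_pull_dotl | exact: comp_pull_dotr].
rewrite (eq_bigl (fun ab : comp A * comp B => [&& is_dot p.1,
  good ab.1 (po_pull (@inl_inj A B) p.1) & good ab.2 (po_pull (@inr_inj A B) p.1)])); last first.
  by move=> [a b]; rewrite /dotP /= !pulls !eqxx !andbT good_dot.
case: ifP => [_|_]; last by rewrite big_pred0.
rewrite big_distrlr pair_big /=; apply: eq_bigr => -[a b] _ /=.
rewrite (coord_teq _ (free_mulE x y lI rI (erefl (comp_seq (comp_dot a b))))).
rewrite coord_tcat !coord_tim; congr (_ * _); apply: eq_coord => S _;
  by apply: pair_eq => i j; rewrite !po_pullE.
Qed.
End TotalCoordinates.

(** * The isomorphism *)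

Section Realization.
Variables (F : finFieldType) (K : fieldType).
Local Notation free := (free_obj (atoms K)).

Section Component.
Variable A : finType.

Lemma realize_subproof (x : free A) (R : PO A) :
  [ffun u : UT F R => \sum_(Q | normal_pair (Q, R) && (u \in pattern F R Q))
     weight x (Q, R) : K^o] \in @Cl_const F K A R.
Proof.
apply/constant_on_ClP => u v uv; rewrite !ffunE; apply: eq_bigl => Q.
case: (boolP (normal_pair _)) => //= Qn; rewrite uv //.
by apply/NPtt_normal; exists Q.
Qed.
(** The basis element of the pair (Q, R) goes to the indicator of [UT_Q] in the component at [R]. *)
Definition realize_fun (x : free A) : ptt_obj F K A :=
  fun R => MkClfun (realize_subproof x R).

Lemma realizeE x R (u : UT F R) : realize_fun x R u =
  \sum_(Q | normal_pair (Q, R) && (u \in pattern F R Q)) weight x (Q, R).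
Proof. by rewrite ffunE. Qed.

Lemma realize_linear : linear realize_fun.
Proof.
move=> a x y; apply: ptt_eq => R u; rewrite !ffunE.
rewrite scaler_sumr -big_split; apply: eq_bigr => Q _ /=; by rewrite weight_linear.
Qed.
HB.instance Definition _ :=
  GRing.isLinear.Build K (free A) (ptt_obj F K A) _ realize_fun realize_linear.
Definition realize : {linear free A -> ptt_obj F K A} := realize_fun.

Lemma realize_inj : injective realize.
Proof.
apply: raddf_inj => x x0; apply: weight_inj => -[Q R]; move: Q; apply: pattern_sum_inj.
by move=> u; apply: etrans (esym (realizeE x u)) _; rewrite [realize_fun x]x0 ffunE.
Qed.

Lemma realize_surj y : exists x, realize x = y.
Proof.
have [G GE] := choice (fun R => pattern_sum_surj (cf_valP (y R))).
have [x xG] := weight_surj (fun p => G p.2 p.1).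
exists x; apply: ptt_eq => R u; rewrite realizeE -GE; apply: eq_bigr => Q /andP[Qn _].
exact: xG.
Qed.
End Component.
Arguments realize {A}.

Lemma pattern_pull (A B : finType) (f : A -> B) (fI : injective f) (R Q : PO B)
    (u : UT F R) : u \in pattern F R Q ->
  ut_pull fI u \in pattern F (po_pull fI R) (po_pull fI Q).
Proof.
move=> /patternP uQ; apply/patternP => i j.
by rewrite ut_pullE po_pullE; exact: uQ.
Qed.

Lemma realize_nat (A B : finType) (f : bij A B) (x : free A) :
  realize (free_map (atoms K) f x) = ptt_map F K f (realize x).
Proof.
pose fI := bij_inj (bij_bijective f); have [g fK gK] := bij_bijective f.
have gI := can_inj gK; apply: ptt_eq => R u; rewrite ptt_mapE !realizeE.
have fgQ (Q : PO B) : po_pull gI (po_pull fI Q) = Q by apply: po_eq => i j; rewrite !po_pullE !gK.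
have gfQ (Q : PO A) : po_pull fI (po_pull gI Q) = Q by apply: po_eq => i j; rewrite !po_pullE !fK.
rewrite [RHS](reindex (po_pull fI)); last by exists (po_pull gI) => Q _.
apply: eq_big => [Q|Q _]; last by rewrite weight_map.
congr (_ && _); first exact/esym/(normal_pull_bij fI (Q, R))/bij_bijective.
apply/idP/idP; first exact: pattern_pull.
move=> /patternP uQ; apply/patternP => i j; have := uQ (g i) (g j).
by rewrite ut_pullE po_pullE !gK.
Qed.

Lemma realize_mul (A B : finType) (x : free A) (y : free B) :
  realize (free_mul x y) = ptt_mul (realize x) (realize y).
Proof.
apply: ptt_eq => R u; rewrite ptt_mulE !realizeE.
under eq_bigr do rewrite weight_mul /=.
case: ifP => dR; last first.
  (* If [Q] inside [R] is an ordinal sum, then so is [R] by antisymmetry; hence every term vanishes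
     here. *)
  rewrite big1 // => Q /andP[/normal_pairP[/= QR _] _]; case: ifP => // /po_dotP dQ.
  case/negP: dR; apply/po_dotP => a b; have /andP[ab _] := dQ a b.
  by rewrite QR //; apply/negP => ba; have := po_anti (QR _ _ ab) ba.
rewrite -big_mkcondr /=.
rewrite (reindex_onto (fun Q => po_dot Q.1 Q.2)
  (fun Q => (po_pull (@inl_inj A B) Q, po_pull (@inr_inj A B) Q))); last first.
  by move=> Q /andP[_ /eqP].
have pulls (P : PO A) (Q : PO B) :
    (po_pull (@inl_inj A B) (po_dot P Q) = P) * (po_pull (@inr_inj A B) (po_dot P Q) = Q).
  by split; apply: po_eq => i j; rewrite !po_pullE po_dotE.
rewrite big_distrlr pair_big /=; apply: eq_big => [[P Q]|[P Q] _] /=; last first.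
  by rewrite /pair_pull /= !pulls.
rewrite /is_dot !pulls !eqxx !andbT normal_dot /= ?pulls //; last exact/eqP.
rewrite /pair_pull /= !pulls.
case: (normal_pair (P, _)) => //=; case: (normal_pair (Q, _)); rewrite ?andbF //=.
apply/idP/andP => [uPQ|[/patternP uP /patternP uQ]].
  by split; [rewrite -[P](pulls P Q).1 | rewrite -[Q](pulls P Q).2]; apply: pattern_pull.
(* Mixed entries impose no condition: from [A] to [B] the ordinal sum allows them, and from [B] to
   [A] they are 0 because [R] splits. *)
apply/patternP; move: dR => /po_dotP dR.
move=> [i|i] [j|j]; rewrite po_dotE //=.
- by have := uP i j; rewrite ut_pullE.
- by have /andP[_ /(ut0 u) ->] := dR j i; rewrite eqxx.
by have := uQ i j; rewrite ut_pullE.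
Qed.

(* A surjective morphism sends the unit to a unit, and units are unique. *)
Lemma realize_one : realize (free_one (atoms K)) = ptt_one F K.
Proof.
have [z zE] := realize_surj (ptt_one F K).
have eV : bij_voidl void = bij_voidr void by apply: bij_eq => -[[]|[]].
rewrite -[LHS](ptt_1l (realize (free_one (atoms K)))) eV -[in LHS]zE -realize_mul.
by rewrite -realize_nat free_1r.
Qed.
End Realization.

(** Needed because [realize] maps out of the free monoid, whereas the required isomorphism maps into
    it. *)
Lemma monoid_iso_inv (K : fieldType) (M N : monoid K) :
  monoid_iso M N -> monoid_iso N M.
Proof.
(* Bijectivity is a proposition, so a preimage is extracted by choice. *)
move=> h; pose inv A y := sval (cid (let: Bijective g fK gK := iso_bij h A in
  ex_intro (fun x => iso_map h A x = y) (g y) (gK y))).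
have invK A : cancel (inv A) (iso_map h A) by move=> y; rewrite /inv; case: cid.
have hI A : injective (iso_map h A) by exact: bij_inj (iso_bij h A).
have invL A : linear (inv A).
  by move=> a x y; apply: (hI A); rewrite linearP !invK.
pose L A := GRing.isLinear.Build K (N A) (M A) _ (inv A) (invL A).
pose invl A : {linear N A -> M A} := HB.pack (inv A) (L A).
apply: (@MonoidIso K N M invl) => [A|A B f x|A B x y|].
- by exists (iso_map h A) => x /=; rewrite ?invK //; apply: (hI A); rewrite invK.
- by apply: (hI B); rewrite /= iso_nat !invK.
- by apply: (hI (A + B)%type); rewrite /= iso_mul !invK.
by apply: (hI void); rewrite /= iso_one !invK.
Qed.

(** There are no atoms on the empty set, since an indecomposable order is nonempty. *)
Lemma atoms_void (K : fieldType) (v : atoms K void) : v = 0.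
Proof.
apply/ffunP => -[p pa]; case/andP: (pa) => _ /asboolP[].
by case/set0Pn => -[].
Qed.

Theorem proposition4p7 (F : finFieldType) (R : realType) :
  exists q : species R[i],
    (forall x : q void, x = 0) /\
    inhabited (monoid_iso (ptt F R[i]) (free_monoid q)).
Proof.
exists (atoms R[i]); split; first exact: atoms_void.
constructor; apply: monoid_iso_inv.
apply: (@MonoidIso _ (free_monoid (atoms R[i])) (ptt F R[i]) (@realize F R[i])).
- move=> A; have [g gE] := choice (@realize_surj F R[i] A).
  by exists g => [x|]; last exact: gE; apply: realize_inj; exact: gE.
- exact: realize_nat.
- exact: realize_mul.
exact: realize_one.
Qed.
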